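(* Let $(W,S)$ be a Coxeter system with $S$ finite, with set of simple roots $\Delta$ and set of elementary roots $\mathscr{E}$. Consider the following procedure. Initialise $L'=S$, $\mathcal{S}'=\Delta$, $\Gamma'=\emptyset$ and $i=1$; throughout, $L'_i$ denotes $\{x\in L'\mid\ell(x)=i\}$. While $L'_i\ne\emptyset$: for every $x\in L'_i$ and every $s\in S$ with $s\notin D_L(x)$, set $y=sx$; if $|\Phi^R(y)|=1$, say $\Phi^R(y)=\{\beta\}$, and $\beta\in\mathscr{E}$, then add $y$ to $L'$, and moreover if there is $z\in L'$ with $\Phi^R(z)=\{\beta\}$ and $\Phi(z)\cap\Phi(y)=\{\beta\}$, then add $\beta$ to $\mathcal{S}'$ and add $y,z$ to $\Gamma'$. After all such $x$ and $s$ are processed, increase $i$ by $1$ and repeat. This procedure terminates in finite time, and upon termination $\Gamma'=\Gamma^0$ and $\mathcal{S}'=\mathcal{S}$, where $\Gamma^0$ is the set of tight gates and $\mathcal{S}$ is the set of super-elementary roots of $(W,S)$.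
   Context: $(W,S)$ is a Coxeter system with $S$ finite and $\ell$ is the word length with respect to $S$. $V$ is the real vector space with basis $\Delta=\{\alpha_s\mid s\in S\}$ (the simple roots) and symmetric bilinear form $\langle\alpha_s,\alpha_t\rangle=-\cos(\pi/m(s,t))$ (equal to $-1$ if $m(s,t)=\infty$); $W$ acts on $V$ by $sv=v-2\langle v,\alpha_s\rangle\alpha_s$. The root system is $\Phi=\{w\alpha_s\mid w\in W,s\in S\}=\Phi^+\sqcup\Phi^-$ (positive and negative roots). The (left) inversion set of $w\in W$ is $\Phi(w)=\{\alpha\in\Phi^+\mid w^{-1}\alpha\in\Phi^-\}$. Descent sets: $D_L(w)=\{s\in S\mid\ell(sw)=\ell(w)-1\}$, $D_R(w)=\{s\in S\mid\ell(ws)=\ell(w)-1\}$; right-descent roots: $\Phi^R(w)=\{-w\alpha_s\mid s\in D_R(w)\}$. Right weak order: $x\preceq y$ iff $\ell(y)=\ell(x)+\ell(x^{-1}y)$. Elementary roots: for $\alpha,\beta\in\Phi^+$, $\beta$ dominates $\alpha$ if for all $w\in W$, $w\beta\in\Phi^-$ implies $w\alpha\in\Phi^-$. A positive root is elementary if it dominates no positive root other than itself. The set $\mathscr{E}$ of elementary roots is known to be finite. Super-elementary roots: $\mathcal{S}=\{\beta\in\Phi^+\mid\exists\,x,y\in W\text{ with }\Phi(x)\cap\Phi(y)=\{\beta\}\}$. Cone type of $w$: $T(w)=\{v\in W\mid\ell(wv)=\ell(w)+\ell(v)\}$; $\mathbb{T}=\{T(w)\mid w\in W\}$. For $T\in\mathbb{T}$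 the cone type part is $Q(T)=\{x\in W\mid T(x^{-1})=T\}$. It is known that each $Q(T)$ has a unique element $g_T\in Q(T)$ with $g_T\preceq x$ for all $x\in Q(T)$ (its gate); $\Gamma=\{g_T\mid T\in\mathbb{T}\}$ and the set of tight gates is $\Gamma^0=\{g\in\Gamma\mid|\Phi^R(g)|=1\}$.
   Formalization: Γ' is initialised to S instead of ∅: with Γ'=∅ the claim fails for every nonempty S (e.g. W=Z/2, S={s}: the procedure ends with Γ'=∅ while Γ^0={s}), because simple reflections are tight gates that the loop never adds. *)

(* Defs.v *)
From HB Require Import structures.
From Stdlib Require Export Relation_Operators.
From mathcomp Require Export all_boot all_order all_algebra.
From mathcomp Require Export all_classical all_reals all_analysis.

Set Implicit Arguments.
Unset Strict Implicit.
Unset Printing Implicit Defensive.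

Import Order.TTheory GRing.Theory Num.Theory.

Local Open Scope classical_set_scope.
Local Open Scope ring_scope.

(** * Coxeter systems *)

(* A Coxeter matrix over the index set S; the value 0 encodes m(s,t) = oo. *)
Definition coxeter_matrix (S : finType) (m : S -> S -> nat) : Prop :=
  [/\ forall s, m s s = 1%N,
      forall s t, m s t = m t s
    & forall s t, s != t -> m s t != 1%N].

(* The congruence on words generated by the relators (s t)^m(s,t).  The relators
   (s s)^m(s,s) = s s make every letter its own inverse, so the monoid presented
   this way is the group < S | (s t)^m(s,t) = 1 >. *)
Inductive coxeter_congr (S : finType) (m : S -> S -> nat) :
    seq S -> seq S -> Prop :=
| congr_rel s t u v : m s t != 0%N ->
    coxeter_congr m (u ++ flatten (nseq (m s t) [:: s; t]) ++ v) (u ++ v)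
| congr_refl u : coxeter_congr m u u
| congr_sym u v : coxeter_congr m u v -> coxeter_congr m v u
| congr_trans u v w :
    coxeter_congr m u v -> coxeter_congr m v w -> coxeter_congr m u w.

Definition word_prod (S : finType) (W : groupType) (gen : S -> W) (u : seq S) : W :=
  (\prod_(s <- u) gen s)%g.

(* (W, gen @` S) is a Coxeter system with Coxeter matrix m: the generators gen s
   present W with the Coxeter relations and no others.  The set S of the
   mathematical text is the range of gen; gen is injective as a consequence. *)
Definition coxeter_system (S : finType) (W : groupType)
    (m : S -> S -> nat) (gen : S -> W) : Prop :=
  [/\ coxeter_matrix m,
      forall w : W, exists u : seq S, word_prod gen u = w
    & forall u v : seq S,
        word_prod gen u = word_prod gen v <-> coxeter_congr m u v].

Section Coxeter.
Variables (R : realType) (S : finType) (W : groupType).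
Variables (m : S -> S -> nat) (gen : S -> W).

Definition reduced_expression (w : W) (u : seq S) : Prop :=
  word_prod gen u = w /\
  forall v : seq S, word_prod gen v = w -> (size u <= size v)%N.

(* A chosen reduced expression; it exists as soon as gen generates W. *)
Definition reduced_word (w : W) : seq S :=
  xget [::] [set u | reduced_expression w u].

Definition len (w : W) : nat := size (reduced_word w).

Definition weak_le (x y : W) : Prop := len y = (len x + len (x^-1 * y)%g)%N.

Definition DL (w : W) : set S := [set s | (len (gen s * w)%g).+1 = len w].
Definition DR (w : W) : set S := [set s | (len (w * gen s)%g).+1 = len w].

(** * The geometric representation and the root system *)

(* R^o is R seen as a module over itself. *)
Definition V : Type := {ffun S -> R^o}.

Definition alpha (s : S) : V := [ffun t => (t == s)%:R].

Definition simple_form (s t : S) : R :=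
  if m s t == 0%N then -1 else - cos (pi / (m s t)%:R).

Definition form (u v : V) : R := \sum_s \sum_t u s * v t * simple_form s t.

Definition refl (s : S) (v : V) : V := v - (2 * form v (alpha s)) *: alpha s.

(* The action of w is the composite of the reflections along an expression of w;
   in a Coxeter system it does not depend on the expression. *)
Definition wact (w : W) (v : V) : V := foldr refl v (reduced_word w).

Definition simple_roots : set V := range alpha.

Definition roots : set V := [set v | exists w s, v = wact w (alpha s)].
Definition pos_roots : set V := roots `&` [set v | forall s, 0 <= v s].
Definition neg_roots : set V := roots `&` [set v | forall s, v s <= 0].

Definition inversions (w : W) : set V :=
  pos_roots `&` [set a | neg_roots (wact (w^-1)%g a)].

(* Right-descent roots. *)
Definition PhiR (w : W) : set V := [set - wact w (alpha s) | s in DR w].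

Definition dominates (b a : V) : Prop :=
  forall w : W, neg_roots (wact w b) -> neg_roots (wact w a).

Definition elementary : set V :=
  pos_roots `&` [set b | forall a, pos_roots a -> dominates b a -> a = b].

Definition super_elementary : set V :=
  pos_roots `&`
  [set b | exists x y : W, inversions x `&` inversions y = [set b]].

(** * Cone types and their gates *)

Definition cone_type (w : W) : set W :=
  [set v | len (w * v)%g = (len w + len v)%N].

Definition cone_types : set (set W) := range cone_type.

Definition cone_part (T : set W) : set W :=
  [set x | cone_type (x^-1)%g = T].

Definition is_gate (T : set W) (g : W) : Prop :=
  cone_part T g /\ forall x, cone_part T x -> weak_le g x.

Definition gates : set W := [set g | exists2 T, cone_types T & is_gate T g].

Definition tight_gates : set W :=
  gates `&` [set g | exists b, PhiR g = [set b]].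

(** * The procedure *)

(* The three sets L', S' and Gamma'. *)
Record state := State { Lset : set W; Sset : set V; Gset : set W }.

(* The counter i and the current sets. *)
Definition config : Type := (nat * state)%type.

(* Gamma' starts with the simple reflections, just as S' starts with the simple
   roots.  Every simple reflection is a tight gate, but a pass only records pairs
   y, z sharing a non-simple right-descent root, so starting from the empty set
   would produce the tight gates other than the simple reflections. *)
Definition init_config : config :=
  (1%N, State (range gen) simple_roots (range gen)).

(* L'_i *)
Definition layer (c : config) : set W := [set x | Lset c.2 x /\ len x = c.1].

(* The body of the loop for the pair (x, s).  All elements z of L' meeting the
   condition are recorded. *)
Definition process (st : state) (p : W * S) : state :=
  let y := (gen p.2 * p.1)%g in
  let good b := PhiR y = [set b] /\ elementary b in
  let L := Lset st `|` [set x | x = y /\ exists b, good b] in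
  let partner b z :=
    [/\ L z, PhiR z = [set b] & inversions z `&` inversions y = [set b]] in
  State L
        (Sset st `|` [set b | good b /\ exists z, partner b z])
        (Gset st `|` [set x | exists b z,
                        [/\ good b, partner b z & x = y \/ x = z]]).

(* The pairs to be processed in the current pass.  Processing the pair (x, s)
   only ever adds s x, of length i + 1, to L', so L'_i is constant during a pass. *)
Definition todo (c : config) : set (W * S) :=
  [set p | layer c p.1 /\ ~ DL p.1 p.2].

(* One pass of the while loop, the pairs being processed in an arbitrary order. *)
Definition pass (c c' : config) : Prop :=
  layer c !=set0 /\
  exists ps : seq (W * S),
    [/\ uniq ps, forall p, (p \in ps) <-> todo c p
      & c' = (c.1.+1, foldl process c.2 ps)].

Definition reachable (c : config) : Prop :=
  clos_refl_trans config pass init_config c.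

(* No execution is infinite, and no execution gets stuck: whenever the loop
   condition holds, the pass can be carried out (it has finitely many pairs). *)
Definition terminates : Prop :=
  Acc (fun c' c => pass c c') init_config /\
  forall c, reachable c -> layer c !=set0 -> exists c', pass c c'.

End Coxeter.

(* Main.v *)
(* The inversion sets govern everything: [x^-1] and [y^-1] have the same cone type iff
   the same inversion sets are disjoint from those of [x] and of [y].  A gate [y] with a
   single right-descent root [b] is separated from the element obtained by removing its
   last letter by some [z] whose inversion set meets that of [y] in [b] only, and [z] can
   be shortened until [b] is its only right-descent root.  Conversely such a pair (y, z)
   makes both [y] and [z] gates: if [x] has the cone type of [y] and [u] is the longest
   common prefix of [x] and [y], then removing the last letter [t] of [z] gives [v] such
   that [v^-1 u], [t] both lie below [v^-1 x] and [v^-1 y]; a common upper bound of these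
   two below both would prolong [u] unless [u = y].  The elements occurring in such pairs
   are closed under suffixes and their roots are elementary, so the procedure meets all
   of them.

   Termination: there are finitely many elementary roots, because on an increasing chain
   of elementary roots the inner products with the simple roots, cut off at -1, take
   finitely many values and cannot repeat; and finitely many elements have a given root
   as their only right-descent root, because there are only finitely many positive roots
   of bounded coordinate sum. *)

From mathcomp Require Import all_boot all_order all_algebra.
From mathcomp Require Import all_classical all_reals all_analysis.
From mathcomp Require Import ring lra zify.
Require Import Defs.

Set Implicit Arguments.
Unset Strict Implicit.
Unset Printing Implicit Defensive.

Import Order.TTheory GRing.Theory Num.Theory.

Local Open Scope classical_set_scope.
Local Open Scope ring_scope.

(** * The form and the dihedral computations *)

Section Geometry.
Variables (R : realType) (S : finType) (m : S -> S -> nat).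
Hypothesis hm : coxeter_matrix m.

Local Notation B := (@form R S m).
Local Notation al := (@alpha R S).

Lemma formDl (u u' v : V R S) : B (u + u') v = B u v + B u' v.
Proof.
rewrite /form -big_split; apply: eq_bigr => s _; rewrite -big_split.
by apply: eq_bigr => t _; rewrite ffunE !mulrDl.
Qed.

Lemma formZl c (u v : V R S) : B (c *: u) v = c * B u v.
Proof.
rewrite /form mulr_sumr; apply: eq_bigr => s _; rewrite mulr_sumr.
by apply: eq_bigr => t _; rewrite ffunE /= -!mulrA.
Qed.

Lemma simple_formC s t : simple_form R m s t = simple_form R m t s.
Proof. by case: hm => _ hC _; rewrite /simple_form hC. Qed.

Lemma formC (u v : V R S) : B u v = B v u.
Proof.
rewrite /form exchange_big; apply: eq_bigr => s _; apply: eq_bigr => t _.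
by rewrite simple_formC [u t * _]mulrC.
Qed.

Lemma formDr (u v v' : V R S) : B u (v + v') = B u v + B u v'.
Proof. by rewrite formC formDl !(formC u). Qed.

Lemma formZr c (u v : V R S) : B u (c *: v) = c * B u v.
Proof. by rewrite formC formZl formC. Qed.

Lemma formNl (u v : V R S) : B (- u) v = - B u v.
Proof. by rewrite -scaleN1r formZl mulN1r. Qed.

Lemma formNr (u v : V R S) : B u (- v) = - B u v.
Proof. by rewrite -scaleN1r formZr mulN1r. Qed.

Lemma form0l (v : V R S) : B 0 v = 0.
Proof. by rewrite -(scale0r 0) formZl mul0r. Qed.

Lemma form_suml (I : Type) (r : seq I) (P : pred I) (F : I -> V R S) v :
  B (\sum_(i <- r | P i) F i) v = \sum_(i <- r | P i) B (F i) v.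
Proof.
by elim/big_rec2: _ => [|i x y _ <-]; rewrite ?form0l// formDl.
Qed.

Definition formE := (formDl, formDr, formNl, formNr, formZl, formZr).

Lemma vec_expand (v : V R S) : v = \sum_s (v s : R) *: al s.
Proof.
apply/ffunP => t; rewrite sum_ffunE (bigD1 t) //= big1 => [|s st].
  by rewrite !ffunE eqxx addr0 /GRing.scale /= mulr1.
by rewrite !ffunE eq_sym (negbTE st) scaler0.
Qed.

Lemma form_alpha s t : B (al s) (al t) = simple_form R m s t.
Proof.
rewrite /form (bigD1 s) //= [X in _ + X]big1 => [|i si]; last first.
  by apply: big1 => j _; rewrite !ffunE (negbTE si) !mul0r.
rewrite (bigD1 t) //= [X in _ + X + _]big1 => [|j tj]; last first.
  by rewrite !ffunE (negbTE tj) mulr0 mul0r.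
by rewrite !ffunE !eqxx !mul1r !addr0.
Qed.

Lemma form_alphaE s : B (al s) (al s) = 1.
Proof.
by case: hm => h1 _ _; rewrite form_alpha /simple_form h1 /= divr1 cospi opprK.
Qed.

Lemma form_expand (v u : V R S) : B v u = \sum_s (v s : R) * B (al s) u.
Proof.
by rewrite {1}(vec_expand v) form_suml; apply: eq_bigr => s _; rewrite formZl.
Qed.

Definition total (v : V R S) : R := \sum_s v s.

Lemma totalD u v : total (u + v) = total u + total v.
Proof. by rewrite /total -big_split; apply: eq_bigr => s _; rewrite ffunE. Qed.

Lemma totalZ c v : total (c *: v) = c * total v.
Proof. by rewrite /total mulr_sumr; apply: eq_bigr => s _; rewrite ffunE. Qed.

Lemma totalN v : total (- v) = - total v.
Proof. by rewrite -scaleN1r totalZ mulN1r. Qed.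

Lemma total0 : total 0 = 0.
Proof. by rewrite -(scale0r 0) totalZ mul0r. Qed.

Lemma total_alpha s : total (al s) = 1.
Proof.
rewrite /total (bigD1 s) //= big1 => [|i si]; last by rewrite ffunE (negbTE si).
by rewrite ffunE eqxx addr0.
Qed.

Lemma alpha_inj : injective al.
Proof.
move=> s t /ffunP/(_ s); rewrite !ffunE eqxx.
by case: eqP => // _ /eqP; rewrite oner_eq0.
Qed.

Definition reflv (a v : V R S) : V R S := v - (2 * B v a) *: a.

Lemma reflE s v : refl m s v = reflv (al s) v. Proof. by []. Qed.

Lemma reflvD a u v : reflv a (u + v) = reflv a u + reflv a v.
Proof. by rewrite /reflv formDl mulrDr scalerDl opprD addrACA. Qed.

Lemma reflvZ a c v : reflv a (c *: v) = c *: reflv a v.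
Proof. by rewrite /reflv formZl scalerBr scalerA mulrCA. Qed.

Lemma reflv_self a : B a a = 1 -> reflv a a = - a.
Proof.
by move=> h; rewrite /reflv h mulr1 scaler_nat mulr2n opprD addrA subrr add0r.
Qed.

Lemma reflvK a : B a a = 1 -> involutive (reflv a).
Proof.
move=> h v; rewrite {1}/reflv /reflv !formE h -addrA -opprD -scalerDl.
rewrite (_ : 2 * _ + _ = 0); first by rewrite scale0r subr0.
by ring.
Qed.

Lemma form_reflv a u v : B a a = 1 -> B (reflv a u) (reflv a v) = B u v.
Proof. by move=> h; rewrite /reflv !formE h (formC a v); ring. Qed.

Lemma reflK s : involutive (@refl R S m s).
Proof. exact/reflvK/form_alphaE. Qed.

Lemma refl_coord s v t : refl m s v t = v t - 2 * B v (al s) * (t == s)%:R :> R.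
Proof. by rewrite /refl !ffunE. Qed.

Lemma total_reflv a v : total (reflv a v) = total v - 2 * B v a * total a.
Proof. by rewrite /reflv totalD totalN totalZ. Qed.

Lemma foldr_reflD (u v : V R S) (w : seq S) :
  foldr (refl m) (u + v) w = foldr (refl m) u w + foldr (refl m) v w.
Proof. by elim: w => //= s w ->; rewrite reflE reflvD. Qed.

Lemma foldr_reflZ c (v : V R S) (w : seq S) :
  foldr (refl m) (c *: v) w = c *: foldr (refl m) v w.
Proof. by elim: w => //= s w ->; rewrite reflE reflvZ. Qed.

Lemma form_foldr_refl (u v : V R S) (w : seq S) :
  B (foldr (refl m) u w) (foldr (refl m) v w) = B u v.
Proof. by elim: w => //= s w IH; rewrite !reflE form_reflv ?form_alphaE. Qed.

(** Chebyshev polynomials of the second kind, shifted by one: at [c = cos x] the value is sin(kx) /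
    sin x. *)
Fixpoint cheb (c : R) (k : nat) : R :=
  match k with
  | 0 => 0
  | k'.+1 => match k' with 0 => 1 | k''.+1 => 2 * c * cheb c k' - cheb c k'' end
  end.

Lemma chebSS c k : cheb c k.+2 = 2 * c * cheb c k.+1 - cheb c k.
Proof. by []. Qed.

Lemma cheb_one k : cheb 1 k = k%:R.
Proof.
suff: cheb 1 k = k%:R /\ cheb 1 k.+1 = k.+1%:R by case.
elim: k => [//|k [IH1 IH2]]; split => //.
by rewrite chebSS IH1 IH2 -!natr1; ring.
Qed.

Lemma cheb_sin x k : cheb (cos x) k * sin x = sin (x *+ k).
Proof.
suff: cheb (cos x) k * sin x = sin (x *+ k) /\
  cheb (cos x) k.+1 * sin x = sin (x *+ k.+1) by case.
elim: k => [|k [IH1 IH2]]; first by rewrite /= mul0r mul1r sin0.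
split => //; rewrite chebSS mulrBl IH1 -[_ * _ * sin x]mulrA IH2.
rewrite (_ : x *+ k.+2 = x *+ k.+1 + x); last by rewrite [RHS]addrC -mulrS.
have -> : x *+ k = x *+ k.+1 - x by rewrite mulrSr addrK.
by rewrite sinB sinD; ring.
Qed.

Definition kap s t : R := - simple_form R m s t.

Lemma kapC s t : kap s t = kap t s.
Proof. by rewrite /kap simple_formC. Qed.

Lemma m_ge2 s t : s != t -> m s t != 0%N -> (2 <= m s t)%N.
Proof. by case: hm => _ _ /[apply]; case: (m s t) => [|[]]. Qed.

Lemma sin_pi_div n : (2 <= n)%N -> 0 < sin (pi / n%:R) :> R.
Proof.
move=> n2; apply: sin_gt0_pi; rewrite divr_gt0 ?pi_gt0 ?ltr0n //=; last by lia.
rewrite ltr_pdivrMr ?ltr0n; last by lia.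
by rewrite ltr_pMr ?pi_gt0 // ltr1n.
Qed.

(** For finite [m s t] this is sin(k pi / m) / sin(pi / m) with k at most m; for the infinite label
    it is [k] itself. *)
Lemma cheb_kap_ge0 s t k : s != t -> (m s t = 0%N \/ k <= m s t)%N ->
  0 <= cheb (kap s t) k.
Proof.
move=> st; have [m0 _|m0 [|km]] := eqVneq (m s t) 0%N.
- by rewrite /kap /simple_form m0 eqxx opprK cheb_one.
- by move/eqP; rewrite (negbTE m0).
have m2 := m_ge2 st m0.
rewrite -(pmulr_lge0 _ (sin_pi_div m2)) /kap /simple_form (negbTE m0) opprK.
rewrite cheb_sin sin_ge0_pi // mulrn_wge0 /=; last by rewrite divr_ge0 ?pi_ge0.
rewrite -(mulr_natr (_ / _) k) mulrAC -mulrA ler_piMr ?pi_ge0 //.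
by rewrite ler_pdivrMr ?ltr0n ?mul1r ?ler_nat //; lia.
Qed.

Fixpoint alt (s t : S) (k : nat) : seq S :=
  if k is k'.+1 then s :: alt t s k' else [::].

Definition next_letter (s t : S) (k : nat) := if odd k then t else s.

Lemma size_alt s t k : size (alt s t k) = k.
Proof. by elim: k s t => //= k IH s t; rewrite IH. Qed.

Lemma alt_rcons s t k : alt s t k.+1 = rcons (alt s t k) (next_letter s t k).
Proof.
elim: k s t => [//|k IH] s t; rewrite [LHS]/= -[t :: _]/(alt t s k.+1) IH /=.
by rewrite /next_letter /=; case: (odd k).
Qed.

Lemma refl_plane s t x y : s != t ->
  refl m s (x *: al s + y *: al t) = (2 * kap s t * y - x) *: al s + y *: al t.
Proof.
move=> st; rewrite reflE /reflv !formE form_alphaE form_alpha simple_formC /kap.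
by rewrite addrAC -scalerBl; congr (_ *: _ + _); ring.
Qed.

Lemma alt_act s t k : s != t ->
  foldr (refl m) (al (next_letter s t k)) (alt s t k) =
  cheb (kap s t) k.+1 *: al s + cheb (kap s t) k *: al t.
Proof.
elim: k s t => [|k IH] s t st; first by rewrite /= scale1r scale0r addr0.
rewrite [alt _ _ _]/=.
have -> : next_letter s t k.+1 = next_letter t s k.
  by rewrite /next_letter /=; case: odd.
by rewrite /= IH 1?eq_sym // kapC addrC refl_plane.
Qed.

Lemma flatten_nseq_alt s t k : flatten (nseq k [:: s; t]) = alt s t (k + k).
Proof. by elim: k => //= k ->; rewrite addnS. Qed.

(** For finite [m s t] and [s] other than [t] the form is nondegenerate on the plane of [al s] and
    [al t]. In the plane the word is a full turn; the orthogonal complement is fixed by both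
    letters. *)
Lemma refl_braid s t (v : V R S) : m s t != 0%N ->
  foldr (refl m) v (flatten (nseq (m s t) [:: s; t])) = v.
Proof.
move=> m0; have [<-|st] := eqVneq s t.
  by case: hm => -> _ _ /=; rewrite reflK.
have m2 := m_ge2 st m0; have sp := sin_pi_div m2.
set n := m s t in m0 m2 sp *; set th := pi / n%:R in sp *.
have kE : kap s t = cos th by rewrite /kap /simple_form -/n (negbTE m0) opprK.
have nth : th *+ n = pi.
  by rewrite -mulr_natr /th divfK // pnatr_eq0.
have sth : sin th != 0 by rewrite gt_eqF.
have c0 : cheb (kap s t) (n + n) = 0.
  apply: (mulIf sth); rewrite kE cheb_sin mulrnDr nth mul0r.
  by rewrite sinDpi sinpi oppr0.
have c1 : cheb (kap s t) (n + n).+1 = 1.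
  apply: (mulIf sth); rewrite kE cheb_sin mulrS mulrnDr nth mul1r.
  by rewrite addrA !sinDpi opprK.
have [k nk] : exists k, (n + n = k.+2)%N by exists (n + n - 2)%N; lia.
have c2 : cheb (kap s t) k.+1 = -1.
  by move: c1; rewrite nk chebSS -nk c0; lra.
rewrite flatten_nseq_alt -/n.
have hs : foldr (refl m) (al s) (alt s t (n + n)) = al s.
  have := alt_act (n + n) st; rewrite /next_letter addnn odd_double -addnn.
  by move->; rewrite c0 c1 scale1r scale0r addr0.
have ht : foldr (refl m) (al t) (alt s t (n + n)) = al t.
  have ok : odd k = false by have := odd_double n; rewrite -addnn nk /= negbK.
  have nl : next_letter s t k.+1 = t by rewrite /next_letter /= ok.
  have tt : foldr (refl m) (al t) [:: t] = (-1) *: al t.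
    by rewrite /= reflE reflv_self ?form_alphaE // scaleN1r.
  rewrite nk alt_rcons nl -cats1 foldr_cat tt foldr_reflZ.
  have := alt_act k.+1 st; rewrite nl => ->.
  by rewrite -nk c0 c2 scale0r add0r scalerA mulrN1 opprK scale1r.
set P := B v (al s); set Q := B v (al t); set K := kap s t.
have K1 : 1 - K ^+ 2 != 0 by rewrite /K kE -sin2cos2 expf_neq0.
(* Orthogonal projection to the plane, by inverting the Gram matrix. *)
pose p := ((P + K * Q) / (1 - K ^+ 2)) *: al s +
          ((Q + K * P) / (1 - K ^+ 2)) *: al t.
have fst : B (al s) (al t) = - K by rewrite form_alpha /K /kap opprK.
have fix0 u : B u (al s) = 0 -> B u (al t) = 0 ->
    forall k', foldr (refl m) u (alt s t k') = u /\ foldr (refl m) u (alt t s k') = u.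
  move=> us ut; elim => //= k' [-> ->].
  by rewrite !reflE /reflv us ut mulr0 !scale0r subr0.
have -> : v = p + (v - p) by rewrite addrC subrK.
rewrite foldr_reflD; congr (_ + _).
  by rewrite /p foldr_reflD !foldr_reflZ hs ht.
apply: (fix0 _ _ _ _).1; rewrite /p !formE ?form_alphaE ?(formC (al t)) fst
  -/P -/Q; field => //.
Qed.

End Geometry.

(** * Words and length *)

Section Length.
Variables (S : finType) (W : groupType) (m : S -> S -> nat) (gen : S -> W).
Hypothesis hW : coxeter_system m gen.

Local Notation wp := (word_prod gen).
Local Notation ln := (len gen).

Let hm : coxeter_matrix m. Proof. by case: hW. Qed.

Lemma word_prod_nil : wp [::] = 1%g.
Proof. by rewrite /word_prod big_nil. Qed.

Lemma word_prod_cons s u : wp (s :: u) = (gen s * wp u)%g.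
Proof. by rewrite /word_prod big_cons. Qed.

Lemma word_prod_cat u v : wp (u ++ v) = (wp u * wp v)%g.
Proof. by rewrite /word_prod big_cat. Qed.

Lemma word_prod_rcons u s : wp (rcons u s) = (wp u * gen s)%g.
Proof. by rewrite -cats1 word_prod_cat word_prod_cons word_prod_nil mulg1. Qed.

Lemma gen_sq s : (gen s * gen s)%g = 1%g.
Proof.
case: hW => -[h1 _ _] _ h; have := (h [:: s; s] [::]).2.
rewrite !word_prod_cons word_prod_nil mulg1; apply.
have := @congr_rel S m s s [::] [::]; rewrite h1 /=; exact.
Qed.

Lemma genV s : (gen s)^-1%g = gen s.
Proof. by rewrite -[RHS]mulg1 -(mulgV (gen s)) mulgA gen_sq mul1g. Qed.

Lemma gen_mulK s w : (gen s * (gen s * w))%g = w.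
Proof. by rewrite mulgA gen_sq mul1g. Qed.

Lemma mul_genK w s : (w * gen s * gen s)%g = w.
Proof. by rewrite -mulgA gen_sq mulg1. Qed.

Lemma word_prod_rev u : wp (rev u) = (wp u)^-1%g.
Proof.
elim: u => [|s u IH]; first by rewrite word_prod_nil invg1.
by rewrite rev_cons word_prod_rcons IH word_prod_cons invgM genV.
Qed.

Lemma reduced_wordP w : reduced_expression gen w (reduced_word gen w).
Proof.
case: hW => _ hs _; have [u0 hu0] := hs w.
pose P n := `[< exists2 u, wp u = w & size u = n >].
have exP : exists n, P n by exists (size u0); apply/asboolP; exists u0.
case: (ex_minnP exP) => n /asboolP[u uw un] nmin.
have ex : reduced_expression gen w u.
  by split => // v vw; rewrite un; apply: nmin; apply/asboolP; exists v.
exact: (@xgetPex _ [::] [set u | reduced_expression gen w u] (ex_intro _ u ex)).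
Qed.

Lemma word_prod_reduced w : wp (reduced_word gen w) = w.
Proof. by case: (reduced_wordP w). Qed.

Lemma len_word u : (ln (wp u) <= size u)%N.
Proof. by case: (reduced_wordP (wp u)) => _; apply. Qed.

Lemma len1 : ln 1%g = 0%N.
Proof. by apply/eqP; rewrite -leqn0 -word_prod_nil (len_word [::]). Qed.

Lemma len_eq0 w : ln w = 0%N -> w = 1%g.
Proof. by move/size0nil => h; rewrite -[w]word_prod_reduced h word_prod_nil. Qed.

Lemma lenM x y : (ln (x * y)%g <= ln x + ln y)%N.
Proof.
rewrite -{1}[x]word_prod_reduced -{1}[y]word_prod_reduced -word_prod_cat.
by apply: leq_trans (len_word _) _; rewrite size_cat.
Qed.

Lemma lenV w : ln w^-1%g = ln w.
Proof.
have h x : (ln x^-1%g <= ln x)%N.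
  rewrite -{1}[x]word_prod_reduced -word_prod_rev.
  by apply: leq_trans (len_word _) _; rewrite size_rev.
by apply/eqP; rewrite eqn_leq h -{1}[w]invgK h.
Qed.

(** All relators have even length. *)
Lemma odd_congr u v : coxeter_congr m u v -> odd (size u) = odd (size v).
Proof.
elim=> // [s t {}u {}v _|{}u {}v w _ -> _ ->//].
rewrite !size_cat !oddD flatten_nseq_alt size_alt addnn odd_double.
by case: (odd (size u)).
Qed.

Lemma odd_len_word u : odd (ln (wp u)) = odd (size u).
Proof.
by case: hW => _ _ h; apply/odd_congr/(h _ _).1; rewrite word_prod_reduced.
Qed.

Lemma len_gen_le s : (ln (gen s) <= 1)%N.
Proof. by have := len_word [:: s]; rewrite word_prod_cons word_prod_nil mulg1. Qed.

Lemma odd_len_mul_gen w s : odd (ln (w * gen s)%g) = ~~ odd (ln w).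
Proof.
by rewrite -{1}[w]word_prod_reduced -word_prod_rcons odd_len_word size_rcons.
Qed.

Lemma len_gen s : ln (gen s) = 1%N.
Proof.
have := len_gen_le s; have := odd_len_mul_gen 1%g s; rewrite mul1g len1.
by case: (ln _) => [|[]].
Qed.

(** The triangle inequality leaves a change by -1, 0 or 1; parity excludes 0. *)
Lemma len_mul_gen w s :
  ln (w * gen s)%g = (ln w).+1 \/ (ln (w * gen s)%g).+1 = ln w.
Proof.
have h1 := lenM w (gen s); have h2 := lenM (w * gen s)%g (gen s).
have h3 := odd_len_mul_gen w s; rewrite mul_genK len_gen in h1 h2.
have [e|[e|e]] : ln (w * gen s)%g = (ln w).+1 \/
  (ln (w * gen s)%g).+1 = ln w \/ ln (w * gen s)%g = ln w by lia.
- by left.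
- by right.
by move: h3; rewrite e; case: odd.
Qed.

Lemma len_gen_mul s w :
  ln (gen s * w)%g = (ln w).+1 \/ (ln (gen s * w)%g).+1 = ln w.
Proof.
rewrite -(lenV (gen s * w)%g) -(lenV w) invgM genV; exact: len_mul_gen.
Qed.

Lemma DRP w s : DR gen w s \/ ln (w * gen s)%g = (ln w).+1.
Proof. by case: (len_mul_gen w s) => ?; [right|left]. Qed.

Lemma DLP w s : DL gen w s \/ ln (gen s * w)%g = (ln w).+1.
Proof. by case: (len_gen_mul s w) => ?; [right|left]. Qed.

Lemma exists_DR (w : W) : w != 1%g -> exists s, DR gen w s.
Proof.
move=> w1; move: (word_prod_reduced w) (erefl (ln w)); rewrite {2}/len.
case/lastP: (reduced_word gen w) => [|u s].
  by rewrite word_prod_nil => e; rewrite -e eqxx in w1.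
rewrite word_prod_rcons size_rcons => uw lw; exists s; rewrite /DR /=.
have h : (ln (w * gen s)%g <= size u)%N by rewrite -uw mul_genK len_word.
by have := len_mul_gen w s; rewrite lw; lia.
Qed.

Lemma DL_inv w s : DL gen w s <-> DR gen w^-1%g s.
Proof. by rewrite /DL /DR /= lenV -[X in X.+1]lenV invgM genV. Qed.

Lemma exists_DL (w : W) : w != 1%g -> exists s, DL gen w s.
Proof.
move=> w1; have [|s hs] := @exists_DR w^-1%g.
  by apply: contra w1 => /eqP e; rewrite -[w]invgK e invg1.
by exists s; apply/DL_inv.
Qed.

Lemma len_ind_r (P : W -> Prop) : P 1%g ->
  (forall w s, ln (w * gen s)%g = (ln w).+1 -> P w -> P (w * gen s)%g) ->
  forall w, P w.
Proof.
move=> P1 PS w; have [n] := ubnP (ln w); elim: n w => // n IH w wn.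
have [->//|/exists_DR[s hs]] := eqVneq w 1%g.
rewrite -(mul_genK w s); apply: PS; first by rewrite mul_genK -hs.
by apply: IH; move: hs; rewrite /DR /= => e; rewrite -e in wn.
Qed.

Lemma len_ind_l (P : W -> Prop) : P 1%g ->
  (forall w s, ln (gen s * w)%g = (ln w).+1 -> P w -> P (gen s * w)%g) ->
  forall w, P w.
Proof.
move=> P1 PS w; rewrite -[w]invgK; move: (w^-1%g).
apply: len_ind_r => [|{}w s h IH]; first by rewrite invg1.
rewrite invgM genV; apply: PS => //.
by rewrite -(genV s) -invgM !lenV.
Qed.

(** * Alternating words and the braid relation *)

Lemma word_prod_alt_add s t k j : wp (alt s t (k + j)) =
  (wp (alt s t k) * wp (if odd k then alt t s j else alt s t j))%g.
Proof.
elim: k s t => [|k IH] s t; first by rewrite /= word_prod_nil mul1g.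
rewrite addSn [alt _ _ _]/= [alt s t k.+1]/= !word_prod_cons IH mulgA /=.
by case: (odd k).
Qed.

Lemma rev_alt (s t : S) k : rev (alt s t k) = if odd k then alt s t k else alt t s k.
Proof.
elim: k s t => // k IH s t; rewrite [in LHS]/= rev_cons IH.
rewrite (alt_rcons s t k) (alt_rcons t s k) /next_letter [odd k.+1]/=.
by case: (odd k).
Qed.

Lemma word_prod_alt_braid s t : m s t != 0%N ->
  wp (alt s t (m s t)) = wp (alt t s (m s t)).
Proof.
move=> m0; set n := m s t in m0 *.
have h : wp (alt s t (n + n)) = 1%g.
  case: hW => _ _ hh; rewrite -word_prod_nil; apply/hh.
  rewrite -flatten_nseq_alt; have := @congr_rel S m s t [::] [::] m0.
  by rewrite cats0.
move: h; rewrite word_prod_alt_add.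
have := rev_alt s t n; have := rev_alt t s n; case: (odd n) => h1 h2 h.
  by rewrite -[LHS](mulgK (wp (alt t s n))) h mul1g -word_prod_rev h1.
by rewrite -h2 word_prod_rev -[LHS](mulgK (wp (alt s t n))) h mul1g.
Qed.

End Length.

(* [lia] distinguishes lengths that differ only in the path to the group structure. *)
Ltac lenlia :=
  repeat match goal with H : context [len _ _] |- _ => revert H end;
  repeat match goal with |- context [len ?g ?x] =>
    let n := fresh "n" in set n := (len g x); clearbody n end; lia.

(** * Positivity of roots *)

Section Action.
Variables (R : realType) (S : finType) (W : groupType).
Variables (m : S -> S -> nat) (gen : S -> W).
Hypothesis hW : coxeter_system m gen.

Local Notation wp := (word_prod gen).
Local Notation ln := (len gen).
Local Notation al := (@alpha R S).
Local Notation act := (@wact R S W m gen).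
Local Notation B := (@form R S m).

Lemma coxeter_systemP : coxeter_matrix m. Proof. by case: hW. Qed.

Lemma congr_act u v (x : V R S) : coxeter_congr m u v ->
  foldr (refl m) x u = foldr (refl m) x v.
Proof.
elim=> // [s t {}u {}v m0|{}u {}v w _ -> _ ->//].
by rewrite !foldr_cat (refl_braid coxeter_systemP).
Qed.

Lemma act_word u x : act (wp u) x = foldr (refl m) x u.
Proof.
rewrite /wact; apply: congr_act; case: hW => _ _ h; apply/h.
by rewrite (word_prod_reduced hW).
Qed.

Lemma act1 x : act 1%g x = x.
Proof. by rewrite -(word_prod_nil gen) act_word. Qed.

Lemma actM w w' x : act (w * w')%g x = act w (act w' x).
Proof.
rewrite -[w](word_prod_reduced hW) -[w'](word_prod_reduced hW).
by rewrite -word_prod_cat !act_word foldr_cat.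
Qed.

Lemma act_gen s x : act (gen s) x = refl m s x.
Proof.
by have := act_word [:: s] x; rewrite word_prod_cons word_prod_nil mulg1.
Qed.

Lemma actK w x : act w^-1%g (act w x) = x.
Proof. by rewrite -actM mulVg act1. Qed.

Lemma actVK w x : act w (act w^-1%g x) = x.
Proof. by rewrite -actM mulgV act1. Qed.

Lemma act_inj w : injective (act w).
Proof. exact: can_inj (actK w). Qed.

Lemma actD w (x y : V R S) : act w (x + y) = act w x + act w y.
Proof. exact: foldr_reflD. Qed.

Lemma actZ w c (x : V R S) : act w (c *: x) = c *: act w x.
Proof. exact: foldr_reflZ. Qed.

Lemma actN w (x : V R S) : act w (- x) = - act w x.
Proof. by rewrite -scaleN1r actZ scaleN1r. Qed.

Lemma act0 w : act w 0 = 0.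
Proof. by rewrite -(scale0r (0 : V R S)) actZ !scale0r. Qed.

Lemma act_sum w (I : Type) (r : seq I) (P : pred I) (F : I -> V R S) :
  act w (\sum_(i <- r | P i) F i) = \sum_(i <- r | P i) act w (F i).
Proof. by elim/big_rec2: _ => [|i x y _ <-]; rewrite ?act0// actD. Qed.

Lemma form_act w x y : B (act w x) (act w y) = B x y.
Proof. exact: form_foldr_refl coxeter_systemP _ _ _. Qed.

Lemma form_act_l w x y : B (act w x) y = B x (act w^-1%g y).
Proof. by rewrite -[in LHS](actVK w y) form_act. Qed.

Lemma act_gen_alpha s : act (gen s) (al s) = - al s.
Proof. by rewrite act_gen reflE reflv_self // (form_alphaE _ coxeter_systemP). Qed.

Definition nonneg (v : V R S) := forall t, 0 <= v t.

Lemma nonnegD u v : nonneg u -> nonneg v -> nonneg (u + v).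
Proof. by move=> hu hv t; rewrite ffunE addr_ge0. Qed.

Lemma nonnegZ c v : 0 <= c -> nonneg v -> nonneg (c *: v).
Proof. by move=> hc hv t; rewrite ffunE mulr_ge0. Qed.

Lemma nonneg_alpha s : nonneg (al s).
Proof. by move=> t; rewrite ffunE ler0n. Qed.

(** Take the longest alternating suffix of [w] in [s] and a descent [t] that can be followed by [s].
    It sends [al s] to a nonnegative combination of [al s] and [al t], and the remaining prefix [v]
    lengthens under both letters, so induction applies to [v]. *)
Lemma act_alpha_ge0 w s : ln (w * gen s)%g = (ln w).+1 ->
  nonneg (act w (al s)).
Proof.
have [n] := ubnP (ln w); elim: n w s => // n IH w s wn ws.
have [->|/(exists_DR hW)[t ht]] := eqVneq w 1%g.
  by rewrite act1; apply: nonneg_alpha.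
have st : s != t by apply/eqP => e; move: ht; rewrite /DR /= -e ws; lia.
pose Q k := `[< exists v x y, [/\ (x, y) = (s, t) \/ (x, y) = (t, s),
   next_letter x y k = s, w = (v * wp (alt x y k))%g & ln w = (ln v + k)%N] >].
have Q1 : Q 1%N.
  apply/asboolP; exists (w * gen t)%g, t, s; split => //; first by right.
    by rewrite /= word_prod_cons word_prod_nil mulg1 (mul_genK hW).
  by rewrite -ht; lia.
have Qle k : Q k -> (k <= ln w)%N.
  by move=> /asboolP[v [x [y [_ _ _ ->]]]]; lia.
case: (ex_maxnP (ex_intro (fun k => is_true (Q k)) _ Q1) Qle).
move=> k /asboolP[v [x [y [xy nx wE lw]]]] kmax.
have k1 : (0 < k)%N by apply: kmax.
have xny : x != y by case: xy => -[-> ->] //; rewrite eq_sym.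
have vx : ln (v * gen x)%g = (ln v).+1.
  have [//|vx] := len_mul_gen hW v x; exfalso.
  have : (ln w <= ln (v * gen x)%g + k.-1)%N.
    rewrite wE -{1}(prednK k1) /= word_prod_cons mulgA.
    apply: leq_trans (lenM hW _ _) _; rewrite leq_add2l.
    by apply: leq_trans (len_word hW _) _; rewrite size_alt.
  by lia.
have vy : ln (v * gen y)%g = (ln v).+1.
  have [//|vy] := len_mul_gen hW v y; exfalso.
  have : (k.+1 <= k)%N; last by lia.
  apply: kmax; apply/asboolP; exists (v * gen y)%g, y, x; split.
  - by case: xy => -[-> ->]; [right|left].
  - by rewrite -nx /next_letter /=; case: odd.
  - by rewrite /= word_prod_cons mulgA (mul_genK hW).
  - by rewrite lw -vy; lia.
(* If [k] reached a finite [m x y], the braid relation would make [w] end in [s], against [ws]. *)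
have km : m x y = 0%N \/ (k.+1 <= m x y)%N.
  have [->|m0] := eqVneq (m x y) 0%N; [by left|right].
  have m2 := m_ge2 coxeter_systemP xny m0.
  rewrite ltnNge; apply/negP => mk.
  set j := (k - m x y)%N; have kE : k = (j + m x y)%N by rewrite /j; lia.
  have [p [q [E pq]]] : exists p q, wp (alt x y k) =
      (wp (alt x y j) * (wp (alt q p (m x y).-1) * gen s))%g /\ True.
    move: nx; rewrite kE word_prod_alt_add /next_letter oddD.
    have h p q : m p q = m x y -> (if odd (m x y) then q else p) = s ->
       wp (alt p q (m x y)) = (wp (alt q p (m x y).-1) * gen s)%g.
      move=> mpq hs; rewrite -mpq (word_prod_alt_braid hW) ?mpq //.
      have -> : alt q p (m x y) = rcons (alt q p (m x y).-1) s.
        rewrite -{1}(@prednK (m x y)); last by lia.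
        rewrite alt_rcons -hs /next_letter.
        have -> : odd (m x y) = ~~ odd (m x y).-1.
          by rewrite -{1}(@prednK (m x y)) //; lia.
        by case: odd.
      by rewrite word_prod_rcons.
    case: (odd j) => /= hs.
      exists y, x; rewrite (h y x) //; first by case: coxeter_systemP.
      by move: hs; case: odd.
    by exists x, y; rewrite (h x y).
  have : (ln (w * gen s)%g <= ln v + (j + (m x y).-1))%N.
    rewrite wE E -!mulgA (gen_sq hW) mulg1.
    apply: leq_trans (lenM hW _ _) _; rewrite leq_add2l -word_prod_cat.
    by apply: leq_trans (len_word hW _) _; rewrite size_cat !size_alt.
  by rewrite ws; lia.
have vn : (ln v < n)%N by lia.
rewrite wE actM act_word -nx (alt_act _ coxeter_systemP) // actD !actZ.
apply: nonnegD; apply: nonnegZ; rewrite ?(cheb_kap_ge0 _ coxeter_systemP) //.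
- exact: IH.
- by case: km; [left|right; lia].
- exact: IH.
Qed.

End Action.

(** * Inversion sets *)

Section Roots.
Variables (R : realType) (S : finType) (W : groupType).
Variables (m : S -> S -> nat) (gen : S -> W).
Hypothesis hW : coxeter_system m gen.

Local Notation ln := (len gen).
Local Notation al := (@alpha R S).
Local Notation act := (@wact R S W m gen).
Local Notation B := (@form R S m).
Local Notation root := (@roots R S W m gen).
Local Notation pos := (@pos_roots R S W m gen).
Local Notation neg := (@neg_roots R S W m gen).
Local Notation inv := (@inversions R S W m gen).
Local Notation hm := (coxeter_systemP hW).

Lemma act_alpha_le0 w s : DR gen w s -> nonneg (- act w (al s)).
Proof.
rewrite /DR /= => h; have := act_alpha_ge0 R hW (w := (w * gen s)%g) (s := s).
by rewrite (mul_genK hW) (actM hW) (act_gen_alpha R hW) actN; apply; rewrite h.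
Qed.

Lemma root_sign v : root v -> nonneg v \/ nonneg (- v).
Proof.
move=> [w [s ->]]; have [h|h] := DRP hW w s.
  by right; apply: act_alpha_le0.
by left; apply: (act_alpha_ge0 _ hW).
Qed.

Lemma root_form v : root v -> B v v = 1.
Proof. by move=> [w [s ->]]; rewrite (form_act hW) (form_alphaE _ hm). Qed.

Lemma root_neq0 v : root v -> v != 0.
Proof.
by move=> /root_form; apply: contra_eq_neq => ->; rewrite form0l eq_sym oner_neq0.
Qed.

Lemma root_alpha s : root (al s).
Proof. by exists 1%g, s; rewrite (act1 hW). Qed.

Lemma root_act w v : root v -> root (act w v).
Proof. by move=> [x [s ->]]; exists (w * x)%g, s; rewrite (actM hW). Qed.

Lemma rootN v : root v -> root (- v).
Proof.
move=> [x [s ->]]; exists (x * gen s)%g, s.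
by rewrite (actM hW) (act_gen_alpha R hW) actN.
Qed.

Lemma pos_root v : pos v -> root v. Proof. by case. Qed.

Lemma negE v : neg v <-> pos (- v).
Proof.
split=> -[rv hv].
  split; first exact: rootN.
  by move=> s; rewrite ffunE oppr_ge0; apply: hv.
split; first by rewrite -[v]opprK; apply: rootN.
by move=> s; have := hv s; rewrite ffunE oppr_ge0.
Qed.

Lemma pos_or_neg v : root v -> pos v \/ pos (- v).
Proof.
by move=> rv; have [h|h] := root_sign rv; [left|right]; split => //; apply: rootN.
Qed.

Lemma nonneg_opp_eq0 (v : V R S) : nonneg v -> nonneg (- v) -> v = 0.
Proof.
move=> h1 h2; apply/ffunP => s; apply/eqP; rewrite !ffunE eq_le h1 andbT.
by have := h2 s; rewrite ffunE oppr_ge0.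
Qed.

Lemma posNN v : pos v -> ~ pos (- v).
Proof.
by move=> [rv h1] [_ h2]; have := root_neq0 rv; rewrite (nonneg_opp_eq0 h1 h2) eqxx.
Qed.

Lemma pos_alpha s : pos (al s).
Proof. by split; [exact: root_alpha|exact: nonneg_alpha]. Qed.

Lemma total_ge0 (v : V R S) : nonneg v -> 0 <= total v.
Proof. by move=> h; apply: sumr_ge0. Qed.

Lemma total_eq0 (v : V R S) : nonneg v -> total v = 0 -> v = 0.
Proof.
move=> h /eqP; rewrite psumr_eq0 // => /allP z; apply/ffunP => s.
by rewrite ffunE; apply/eqP/(z s); rewrite mem_index_enum.
Qed.

Lemma total_gt0 v : pos v -> 0 < total v.
Proof.
move=> [rv h]; rewrite lt_neqAle total_ge0 // andbT eq_sym.
by apply: contra (root_neq0 rv) => /eqP /(total_eq0 h) ->.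
Qed.

Lemma len_mul_gen_pos w s : ln (w * gen s)%g = (ln w).+1 <-> pos (act w (al s)).
Proof.
have rw : root (act w (al s)) by apply/root_act/root_alpha.
split=> [h|h]; first by split => //; exact: (act_alpha_ge0 _ hW).
have [/act_alpha_le0 hn|//] := DRP hW w s.
by case: (posNN h); split => //; apply: rootN.
Qed.

Lemma DR_pos w s : DR gen w s <-> pos (- act w (al s)).
Proof.
have rw : root (act w (al s)) by apply/root_act/root_alpha.
split=> [/act_alpha_le0 h|h]; first by split => //; apply: rootN.
by have [//|/len_mul_gen_pos hp] := DRP hW w s; case: (posNN hp).
Qed.

Lemma DL_pos w s : DL gen w s <-> pos (- act w^-1%g (al s)).
Proof. by rewrite (DL_inv hW); apply: DR_pos. Qed.

Lemma len_gen_mul_pos w s :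
  ln (gen s * w)%g = (ln w).+1 <-> pos (act w^-1%g (al s)).
Proof.
rewrite -len_mul_gen_pos -(lenV hW (gen s * w)%g) -(lenV hW w) invgM.
by rewrite (genV hW).
Qed.

Lemma refl_opp s v : refl m s (- v) = - refl m s v :> V R S.
Proof. by rewrite !reflE -scaleN1r reflvZ scaleN1r. Qed.

Lemma refl_alpha s : refl m s (al s) = - al s.
Proof. by rewrite reflE reflv_self // (form_alphaE _ hm). Qed.

Lemma root_refl s v : root v -> root (refl m s v).
Proof. by rewrite -(act_gen hW); apply: root_act. Qed.

(** Only the coordinate at [s] changes. If the image is negative, [v] is a nonnegative multiple of
    [al s], and of norm 1. *)
Lemma pos_refl s v : pos v -> v != al s -> pos (refl m s v).
Proof.
move=> [rv pv] vs; have [//|[_ h]] := pos_or_neg (root_refl s rv).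
have vt t : t != s -> v t = 0.
  move=> ts; apply/eqP; rewrite eq_le pv andbT.
  by have := h t; rewrite ffunE oppr_ge0 refl_coord (negbTE ts) mulr0 subr0.
have vE : v = (v s : R) *: al s.
  by rewrite [LHS]vec_expand (bigD1 s) //= big1 ?addr0 // => t /vt ->; rewrite scale0r.
have := root_form rv; rewrite vE formZl (formZr hm) (form_alphaE _ hm) mulr1.
have := pv s; move: (v s : R) vE => c vE c0 /eqP.
rewrite -expr2 sqrf_eq1 => /orP[] /eqP e.
  by rewrite vE e scale1r eqxx in vs.
by move: c0; rewrite e lerNr oppr0 ler10.
Qed.

Lemma root_reflection a : root a -> exists w, forall v, act w v = reflv m a v.
Proof.
move=> [x [s ->]]; exists (x * gen s * x^-1)%g => v.
rewrite !(actM hW) (act_gen hW) reflE /reflv actD actN actZ (actVK hW).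
by rewrite (form_act_l hW) invgK.
Qed.

Lemma root_reflv a v : root a -> root v -> root (reflv m a v).
Proof. by move=> /root_reflection[w <-]; apply: root_act. Qed.

Lemma invE w v : inv w v <-> pos v /\ pos (- act w^-1%g v).
Proof. by split=> -[pv /negE]. Qed.

Lemma inv_pos w v : inv w v -> pos v. Proof. by case. Qed.

Lemma inv1 v : ~ inv 1%g v.
Proof. by move=> /invE[pv]; rewrite invg1 (act1 hW); apply: posNN. Qed.

Lemma inv_gen_mul s w v : ln (gen s * w)%g = (ln w).+1 ->
  inv (gen s * w)%g v <-> v = al s \/ inv w (refl m s v).
Proof.
move=> /len_gen_mul_pos ps; rewrite !invE invgM (genV hW) (actM hW) (act_gen hW).
have [->|vs] := eqVneq v (al s).
  rewrite refl_alpha actN opprK; split; [by left|by split => //; exact: pos_alpha].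
split=> [[pv h]|[e|[pv h]]].
- by right; split => //; apply: pos_refl.
- by rewrite e eqxx in vs.
- split=> //; rewrite -[v](reflK hm s); apply: pos_refl => //.
  by apply/eqP => e; move: h; rewrite e; exact: posNN.
Qed.

Lemma inv_gen s v : inv (gen s) v <-> v = al s.
Proof.
rewrite -[gen s]mulg1 inv_gen_mul; last by rewrite mulg1 (len_gen hW) (len1 hW).
by split=> [[//|/inv1]|]; [|left].
Qed.

Lemma inv_finite w : finite_set (inv w).
Proof.
elim/(len_ind_l hW): w => [|w s h IH].
  by apply: (sub_finite_set (B := set0)) => // v /inv1.
apply: (sub_finite_set (B := [set al s] `|` (refl m s @` inv w))).
  move=> v /(inv_gen_mul _ h)[->|hv]; first by left.
  by right; exists (refl m s v) => //; apply: (reflK hm).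
by rewrite finite_setU; split => //; apply: finite_image.
Qed.

(** Induction on [x]: moving its last letter to the front of [y] reflects both inversion sets and
    transfers a simple root from one to the other. *)
Lemma len_mul_inv x y :
  ln (x * y)%g = (ln x + ln y)%N <-> forall v, inv x^-1%g v -> ~ inv y v.
Proof.
elim/(len_ind_r hW): x y => [|x s h IH] y.
  rewrite mul1g (len1 hW) add0n invg1; split => // _ v /inv1; exact.
have hs : ln (gen s * x^-1)%g = (ln x^-1%g).+1.
  by rewrite -(genV hW) -invgM !(lenV hW).
have xs v : inv (x * gen s)^-1%g v <-> v = al s \/ inv x^-1%g (refl m s v).
  by rewrite invgM (genV hW); apply: inv_gen_mul.
rewrite -mulgA; split=> [e v|e].
  have l1 := lenM hW x (gen s * y)%g.
  have sy : ln (gen s * y)%g = (ln y).+1.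
    rewrite h in e; case: (len_gen_mul hW s y) => // e2.
    by move: l1; rewrite e -e2; lenlia.
  have /IH e' : ln (x * (gen s * y))%g = (ln x + ln (gen s * y))%N by lenlia.
  have ns : ~ inv y (al s).
    move=> /invE[_]; apply: posNN; exact/len_gen_mul_pos.
  move=> /xs[->//|/e' h1 h2]; apply: h1; apply/(inv_gen_mul _ sy); right.
  by rewrite (reflK hm).
have sy : ln (gen s * y)%g = (ln y).+1.
  apply/len_gen_mul_pos; have : ~ inv y (al s) by apply: e; apply/xs; left.
  have := pos_or_neg (root_act y^-1%g (root_alpha s)) => -[//|pn] ni.
  by case: ni; apply/invE; split => //; apply: pos_alpha.
have /IH -> : forall v, inv x^-1%g v -> ~ inv (gen s * y)%g v;
  last by rewrite sy h; lenlia.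
move=> v hv /(inv_gen_mul _ sy)[vs|iv].
  move: hv => /invE[_]; rewrite invgK vs; apply: posNN.
  exact/len_mul_gen_pos.
by apply: (e (refl m s v)) => //; apply/xs; right; rewrite (reflK hm).
Qed.

(** * The right weak order *)

Lemma weak_le_decomp x y : weak_le gen x y ->
  exists z, y = (x * z)%g /\ ln y = (ln x + ln z)%N.
Proof. by exists (x^-1 * y)%g; rewrite mulVKg. Qed.

Lemma weak_le1 x : weak_le gen 1%g x.
Proof. by rewrite /weak_le (len1 hW) invg1 mul1g. Qed.

Lemma weak_le_refl x : weak_le gen x x.
Proof. by rewrite /weak_le mulVg (len1 hW) addn0. Qed.

Lemma weak_le_trans x y z : weak_le gen x y -> weak_le gen y z -> weak_le gen x z.
Proof.
rewrite /weak_le => h1 h2.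
have := lenM hW (x^-1 * y)%g (y^-1 * z)%g; have := lenM hW x (x^-1 * z)%g.
by rewrite mulVKg -!mulgA mulVKg; lenlia.
Qed.

Lemma weak_le_len x y : weak_le gen x y -> (ln x <= ln y)%N.
Proof. by rewrite /weak_le => ->; apply: leq_addr. Qed.

(** With [y = x z] of additive length, [- x^-1 v] is an inversion of [x^-1], hence not of [z], so
    [v] stays inverted. *)
Lemma weak_le_inv x y v : weak_le gen x y -> inv x v -> inv y v.
Proof.
move=> /weak_le_decomp[z [-> /len_mul_inv h]].
move=> /invE[pv pn]; apply/invE; split => //.
have := h (- act x^-1%g v); rewrite !invE invgK actN (actVK hW) opprK => h'.
have rz : root (act z^-1%g (- act x^-1%g v)).
  by apply/root_act/rootN/root_act/pos_root.
have := pos_or_neg rz; rewrite invgM (actM hW) !actN opprK => -[//|hp].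
by case: (h' (conj pn pv)); split => //; rewrite actN opprK.
Qed.

Lemma weak_le_mul_gen w s : DR gen w s -> weak_le gen (w * gen s)%g w.
Proof.
rewrite /DR /= => h; rewrite /weak_le invgM (genV hW) -mulgA mulVg mulg1.
by rewrite (len_gen hW) -h addn1.
Qed.

Lemma inv_DR w s : DR gen w s -> inv w (- act w (al s)).
Proof.
move=> h; apply/invE; split; first exact/DR_pos.
by rewrite actN opprK (actK hW); apply: pos_alpha.
Qed.

Lemma inv_mul_gen w s v : DR gen w s ->
  inv (w * gen s)%g v <-> inv w v /\ v <> - act w (al s).
Proof.
move=> hs; split=> [h|[/invE[pv pn] ne]].
  split; first exact: weak_le_inv (weak_le_mul_gen hs) h.
  move=> e; move: h; rewrite e => /invE[_].
  rewrite invgM (genV hW) (actM hW) actN (actK hW) (actN m gen).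
  by rewrite (act_gen_alpha R hW) !opprK; apply/posNN/pos_alpha.
apply/invE; split=> //; rewrite invgM (genV hW) (actM hW) (act_gen hW).
rewrite -refl_opp; apply: pos_refl => //.
by apply/eqP => e; apply: ne; rewrite -e actN opprK (actVK hW).
Qed.

Lemma DL_of_weak_le x y s : weak_le gen x y -> DL gen x s -> DL gen y s.
Proof.
move=> h /DL_pos pn; apply/DL_pos.
have /(weak_le_inv h)/invE[] // : inv x (al s).
by apply/invE; split => //; exact: pos_alpha.
Qed.

Lemma DL_weak_le w s : DL gen w s <-> weak_le gen (gen s) w.
Proof.
rewrite /DL /weak_le /= (genV hW) (len_gen hW) add1n.
by split => ->.
Qed.

Lemma weak_le_gen_mul x y s : DL gen x s -> weak_le gen x y ->
  weak_le gen (gen s * x)%g (gen s * y)%g.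
Proof.
move=> hx hxy; have := DL_of_weak_le hxy hx; move: hx hxy.
rewrite /DL /weak_le /= invgM -mulgA (mulKg (gen s)) => e1 e2 e3.
by move: e2; rewrite -e1 -e3; lenlia.
Qed.

End Roots.

(** * Gates of cone types *)

Section Gates.
Variables (R : realType) (S : finType) (W : groupType).
Variables (m : S -> S -> nat) (gen : S -> W).
Hypothesis hW : coxeter_system m gen.

Local Notation wp := (word_prod gen).
Local Notation ln := (len gen).
Local Notation al := (@alpha R S).
Local Notation act := (@wact R S W m gen).
Local Notation root := (@roots R S W m gen).
Local Notation pos := (@pos_roots R S W m gen).
Local Notation inv := (@inversions R S W m gen).
Local Notation hm := (coxeter_systemP hW).
Local Notation "x <=w y" := (weak_le gen x y) (at level 70).

(** The prefix carries the root of the next letter to a nonnegative combination of [al s] and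
    [al t], both made negative by [p^-1]; so that letter is a left descent of the rest of [p]. *)
Lemma DL_alt_weak_le p s t k : s != t -> DL gen p s -> DL gen p t ->
  (m s t = 0%N \/ k <= m s t)%N ->
  wp (alt s t k) <=w p /\ ln (wp (alt s t k)) = k.
Proof.
move=> st ps pt; elim: k => [_|k IH hk].
  by rewrite /= word_prod_nil (len1 hW); split => //; apply: (weak_le1 hW).
have hk' : (m s t = 0%N \/ k <= m s t)%N by case: hk; [left|right; lia].
have [/weak_le_decomp[y [pE lp]] lx] := IH hk'.
set x := wp (alt s t k) in pE lp lx; set c := next_letter s t k.
have xc : act x (al c) = cheb (kap R m s t) k.+1 *: al s + cheb (kap R m s t) k *: al t.
  by rewrite (act_word hW) (alt_act _ hm).
have pxc : pos (act x (al c)).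
  split; first exact/root_act/root_alpha.
  rewrite xc; apply: nonnegD; apply: nonnegZ; rewrite ?(cheb_kap_ge0 _ hm) //;
    exact: nonneg_alpha.
have dy : DL gen y c.
  apply/(DL_pos R hW); split; first exact/rootN/root_act/root_alpha.
  have -> : act y^-1%g (al c) = act p^-1%g (act x (al c)).
    by rewrite pE invgM (actM hW) (actK hW).
  rewrite xc actD !actZ opprD -!scalerN; apply: nonnegD; apply: nonnegZ;
    rewrite ?(cheb_kap_ge0 _ hm) //.
    by have /(DL_pos R hW)[] := ps.
  by have /(DL_pos R hW)[] := pt.
have lxc : ln (x * gen c)%g = k.+1 by rewrite -lx; apply/(len_mul_gen_pos R hW).
rewrite alt_rcons -/c word_prod_rcons -/x; split => //.
rewrite /weak_le lxc pE invgM (genV hW) -!mulgA mulKg.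
by move: dy; rewrite /DL /= -pE => dy; lenlia.
Qed.

(* The longest element of a finite dihedral parabolic subgroup: it does not depend
   on the element [p] above it. *)
Lemma DL_alt_join s t : s != t -> (exists p, DL gen p s /\ DL gen p t) ->
  let d := wp (alt s t (m s t)) in
  [/\ DL gen d s, DL gen d t & forall p, DL gen p s -> DL gen p t -> d <=w p].
Proof.
move=> st [p [ps pt]] d.
have m0 : m s t != 0%N.
  apply/eqP => m0; have [|/weak_le_len h1 h2] := DL_alt_weak_le (k := (ln p).+1) st ps pt.
    by left.
  by rewrite h2 ltnn in h1.
have m2 := m_ge2 hm st m0.
have [|_ ld] := DL_alt_weak_le (k := m s t) st ps pt; first by right.
have dl x y : wp (alt x y (m s t)) = d -> DL gen d x.
  move=> dE; have [//|] := DLP hW d x; rewrite -dE -(@prednK (m s t)); last by lia.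
  rewrite /= word_prod_cons (gen_mulK hW) -word_prod_cons.
  have := len_word hW (alt y x (m s t).-1); rewrite size_alt.
  move: ld; rewrite -/d -dE -{1}(@prednK (m s t)) /=; last by lia.
  by move=> *; lenlia.
split; first exact: dl.
  by apply: (dl t s); rewrite /d (word_prod_alt_braid hW).
move=> p' ps' pt'; have [|//] := DL_alt_weak_le (k := m s t) st ps' pt'; by right.
Qed.

(** [s] is no left descent of [gen s * p], hence none of [j], so prefixing [s] lengthens [j]. *)
Lemma weak_le_lift s x p j : DL gen x s -> DL gen p s ->
  (gen s * x)%g <=w j -> j <=w (gen s * p)%g ->
  x <=w (gen s * j)%g /\ (gen s * j)%g <=w p.
Proof.
move=> xs ps h1 h2.
have [js|js] := DLP hW j s.
  have := DL_of_weak_le R hW h2 js; move: ps; rewrite /DL /= (gen_mulK hW).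
  by move=> *; exfalso; lenlia.
move: xs ps h1 h2; rewrite /DL /weak_le /= !invgM (genV hW) -!mulgA.
by rewrite ?(gen_mulK hW) => *; split; lenlia.
Qed.

(** Induction on [ln p]. A common first letter is stripped. For different first letters [s] and [r],
    the longest element [d] of their dihedral group links them: it begins with both letters and lies
    below [p] and [p']. *)
Lemma weak_le_join p p' q h : q <=w p -> h <=w p -> q <=w p' -> h <=w p' ->
  exists j, [/\ q <=w j, h <=w j, j <=w p & j <=w p'].
Proof.
have [n] := ubnP (ln p); elim: n p p' q h => // n IH p p' q h pn qp hp qp' hp'.
have [->|/(exists_DL hW)[s qs]] := eqVneq q 1%g.
  by exists h; split => //; [exact: (weak_le1 hW)|exact: (weak_le_refl hW)].
have [->|/(exists_DL hW)[r hr]] := eqVneq h 1%g.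
  by exists q; split => //; [exact: (weak_le_refl hW)|exact: (weak_le1 hW)].
have step x a b : DL gen a x -> DL gen b x -> a <=w p -> b <=w p -> a <=w p' ->
    b <=w p' -> exists j, [/\ a <=w j, b <=w j, j <=w p & j <=w p'].
  move=> ax bx ap bp ap' bp'.
  have px := DL_of_weak_le R hW ap ax; have px' := DL_of_weak_le R hW ap' ax.
  have ln_xp : (ln (gen x * p)%g < n)%N by move: px; rewrite /DL /= => *; lenlia.
  have [j [aj bj jp jp']] := IH _ _ _ _ ln_xp
    (weak_le_gen_mul R hW ax ap) (weak_le_gen_mul R hW bx bp)
    (weak_le_gen_mul R hW ax ap') (weak_le_gen_mul R hW bx bp').
  exists (gen x * j)%g.
  have [a1 j1] := weak_le_lift ax px aj jp; have [b1 j2] := weak_le_lift bx px' bj jp'.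
  by split.
have [sr|sr] := eqVneq s r; first by apply: (step s) => //; rewrite sr.
have ps := DL_of_weak_le R hW qp qs; have pr := DL_of_weak_le R hW hp hr.
have ps' := DL_of_weak_le R hW qp' qs; have pr' := DL_of_weak_le R hW hp' hr.
have [||ds dr dmin] := @DL_alt_join s r; [by []|by exists p|].
set d := wp _ in ds dr dmin; have dp := dmin _ ps pr; have dp' := dmin _ ps' pr'.
have [J1 [qJ1 dJ1 J1p J1p']] := step s q d qs ds qp dp qp' dp'.
have [J2 [hJ2 dJ2 J2p J2p']] := step r h d hr dr hp dp hp' dp'.
have [J [J1J J2J Jp Jp']] := step r J1 J2 (DL_of_weak_le R hW dJ1 dr)
  (DL_of_weak_le R hW dJ2 dr) J1p J2p J1p' J2p'.
by exists J; split => //; apply: (weak_le_trans hW); eassumption.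
Qed.

(** * Elements with a single right-descent root *)

Lemma mulVg_cancel (v x y : W) : ((v^-1 * x)^-1 * (v^-1 * y) = x^-1 * y)%g.
Proof. by rewrite invgM invgK -mulgA mulVKg. Qed.

Lemma PhiR_set1 w b : PhiR m gen w = [set b] ->
  exists t, [/\ DR gen w t, b = - act w (al t) & forall s, DR gen w s -> s = t].
Proof.
move=> e; have [t ht be] : PhiR m gen w b by rewrite e.
exists t; split => // s hs.
have : PhiR m gen w (- act w (al s)) by exists s.
rewrite e => /= es; apply/(@alpha_inj R S)/(act_inj hW (w := w))/oppr_inj.
by rewrite es be.
Qed.

Lemma PhiR_inv w b : PhiR m gen w = [set b] -> inv w b.
Proof. by move=> /PhiR_set1[t [ht -> _]]; apply: inv_DR. Qed.

(** A proper prefix of [y] lies below [y * gen t] for the only right descent [t], and the inversion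
    set of that element lacks [b]. *)
Lemma PhiR_prefix u y b : PhiR m gen y = [set b] -> u <=w y -> u <> y -> ~ inv u b.
Proof.
move=> /PhiR_set1[t [yt be tu]] /weak_le_decomp[z [yE ly]] uy.
have [z1|/(exists_DR hW)[r zr]] := eqVneq z 1%g.
  by case: uy; rewrite yE z1 mulg1.
have yr : DR gen y r.
  have := lenM hW u (z * gen r)%g; rewrite mulgA -yE.
  move: zr; rewrite /DR /=; have := len_mul_gen hW y r => *; lenlia.
have rt := tu r yr; subst r.
have uyt : u <=w (y * gen t)%g.
  move: zr yr; rewrite /DR /weak_le /= yE -!mulgA mulKg -yE => *; lenlia.
by move=> /(weak_le_inv hW uyt)/(inv_mul_gen hW _ yt)[_]; rewrite be.
Qed.

(** Remove last letters as long as one has a root other than [b]. This keeps [b] as an inversion,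
    and at the end every right descent has root [b]. *)
Lemma exists_tight_prefix v b : inv v b ->
  exists z, z <=w v /\ PhiR m gen z = [set b].
Proof.
have [n] := ubnP (ln v); elim: n v => // n IH v vn vb.
have [[s [vs ne]]|h] := pselect (exists s, DR gen v s /\ b <> - act v (al s)).
  have [||z [zv zb]] := IH (v * gen s)%g.
  - by move: vs; rewrite /DR /= => *; lenlia.
  - exact/(inv_mul_gen hW).
  exists z; split => //; apply: (weak_le_trans hW) zv _.
  exact: (weak_le_mul_gen hW).
have all s : DR gen v s -> - act v (al s) = b.
  by move=> vs; have [//|ne] := pselect (- act v (al s) = b); case: h; exists s;
    split => // e; apply: ne.
exists v; split; first exact: (weak_le_refl hW).
have [v1|/(exists_DR hW)[s vs]] := eqVneq v 1%g.
  by move: vb; rewrite v1 => /(inv1 hW).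
apply/seteqP; split => [_ [r vr <-]|_ ->] /=; first exact: all.
by exists s => //; apply: all.
Qed.

Lemma cone_typeVE x v :
  cone_type gen x^-1%g v <-> forall b, inv x b -> ~ inv v b.
Proof.
by rewrite -[in X in _ <-> X](invgK x) -(len_mul_inv R hW).
Qed.

(* By [tight_gatesP] and [super_elementaryP] below, these triples describe both the
   tight gates and the super-elementary roots; they are what the procedure searches. *)
Definition partners (b : V R S) (y z : W) : Prop :=
  [/\ PhiR m gen y = [set b], PhiR m gen z = [set b]
    & inv y `&` inv z = [set b]].

Lemma partnersC b y z : partners b y z -> partners b z y.
Proof. by case=> h1 h2 h3; split => //; rewrite setIC. Qed.

Lemma partners_gate b y z : partners b y z ->
  is_gate gen (cone_type gen y^-1%g) y.
Proof.
move=> [yb zb yz]; split => // x; rewrite /cone_part /= => xy.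
have [t [zt be tu]] := PhiR_set1 zb.
have yzb c : inv y c -> inv z c -> c = b.
  by move=> h1 h2; have : (inv y `&` inv z) c by []; rewrite yz.
have izb := PhiR_inv zb; have iyb := PhiR_inv yb.
set v := (z * gen t)%g.
have vE c : inv v c <-> inv z c /\ c <> b by rewrite be; apply: inv_mul_gen.
have vy : cone_type gen y^-1%g v.
  by apply/cone_typeVE => c yc /vE[zc]; apply; apply: yzb.
have vx : forall c, inv x c -> ~ inv v c by apply/cone_typeVE; rewrite xy.
(* [z] is outside the cone type of [y^-1], hence of [x^-1], while [v] is inside; so [b] must be an
   inversion shared by [x] and [z]. *)
have ixb : inv x b.
  have : ~ cone_type gen x^-1%g z by rewrite xy => /cone_typeVE/(_ b iyb).
  move=> nx; have [//|nb] := pselect (inv x b); case: nx; apply/cone_typeVE.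
  move=> c xc zc; apply: (vx _ xc); apply/vE; split => // cb.
  by apply: nb; rewrite -cb.
(* The longest common prefix of [x] and [y] will turn out to be [y]. *)
pose P k := `[< exists u, [/\ u <=w x, u <=w y & ln u = k] >].
have P0 : exists k, P k.
  exists 0%N; apply/asboolP; exists 1%g.
  by split; rewrite ?(len1 hW) //; exact: (weak_le1 hW).
have Pmax k : P k -> (k <= ln y)%N.
  by move=> /asboolP[u [_ /weak_le_len uy <-]].
case: (ex_maxnP P0 Pmax) => k /asboolP[u [ux uy uk]] kmax.
have [<-//|/eqP uny] := eqVneq u y; exfalso.
have iub := PhiR_prefix yb uy uny.
have lv w : (forall c, inv w c -> ~ inv v c) -> ln (v^-1 * w)%g = (ln v + ln w)%N.
  move=> hw; rewrite -(lenV hW v); apply/(len_mul_inv R hW) => c; rewrite invgK.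
  by move=> vc wc; apply: hw wc vc.
have lx := lv x vx; have ly := lv y ((cone_typeVE _ _).1 vy).
have lu : ln (v^-1 * u)%g = (ln v + ln u)%N.
  by apply: lv => c /(weak_le_inv hW ux); apply: vx.
have qle w : u <=w w -> ln (v^-1 * w)%g = (ln v + ln w)%N ->
    (v^-1 * u)%g <=w (v^-1 * w)%g.
  by rewrite /weak_le mulVg_cancel => *; lenlia.
have vt : act v (al t) = b.
  by rewrite (actM hW) (act_gen_alpha R hW) actN be.
(* As [v] sends [al t] to [b], the first letter [t] of [v^-1 w] detects the inversion [b] of [w]. *)
have DLv w : DL gen (v^-1 * w)%g t <-> inv w b.
  rewrite (DL_pos R hW) (invE hW) invgM invgK (actM hW) vt; split => [h|[]//].
  by split => //; apply: inv_pos izb.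
have [||||j [qj tj jx jy]] := @weak_le_join (v^-1 * x)%g (v^-1 * y)%g (v^-1 * u)%g (gen t).
- exact: qle.
- by apply/(DL_weak_le hW)/DLv.
- exact: qle.
- by apply/(DL_weak_le hW)/DLv.
have [e [jE lj]] := weak_le_decomp qj.
(* [t] lies below [j] but not below [v^-1 u], since [b] is no inversion of [u]; hence [u e] is a
   strictly longer common prefix. *)
have e0 : (0 < ln e)%N.
  rewrite lt0n; apply/eqP => /(len_eq0 hW) e1; apply: iub; apply/DLv.
  by apply/(DL_weak_le hW); move: tj; rewrite jE e1 mulg1.
have ue w : ln (v^-1 * w)%g = (ln v + ln w)%N -> j <=w (v^-1 * w)%g ->
    (u * e)%g <=w w /\ ln (u * e)%g = (ln u + ln e)%N.
  move=> lw; rewrite /weak_le lw lj lu jE.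
  rewrite -[(v^-1 * u * e)%g]mulgA mulVg_cancel.
  have := lenM hW (u * e)%g ((u * e)^-1 * w)%g; rewrite mulVKg.
  have := lenM hW u e => *; lenlia.
have [uex lue] := ue x lx jx; have [uey _] := ue y ly jy.
have : (k.+1 <= k)%N; last by rewrite ltnn.
apply: leq_trans (kmax (ln (u * e)%g) _); first by lenlia.
by apply/asboolP; exists (u * e)%g.
Qed.

Lemma tight_gatesP y : tight_gates R m gen y <-> exists b z, partners b y z.
Proof.
split=> [[[T _ [yT ymin]] [b yb]]|[b [z h]]]; last first.
  split; last by exists b; case: h.
  by exists (cone_type gen y^-1%g); [exists y^-1%g|exact: partners_gate h].
have [t [yt be _]] := PhiR_set1 yb.
have yz c : inv (y * gen t)%g c <-> inv y c /\ c <> b.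
  by rewrite be; apply: inv_mul_gen.
suff [v [v1 v2]] : exists v, cone_type gen (y * gen t)^-1%g v /\
    ~ cone_type gen y^-1%g v.
  move/cone_typeVE: v1 => v1.
  have bv c : inv y c -> inv v c -> c = b.
    move=> yc vc; have [//|cb] := pselect (c = b).
    by case: (v1 c) => //; apply/yz.
  have vb : inv v b.
    have [//|nb] := pselect (inv v b); case: v2; apply/cone_typeVE => c yc vc.
    by apply: nb; rewrite -(bv c).
  have [z [zv zb]] := exists_tight_prefix vb; exists b, z; split => //.
  apply/seteqP; split => [c [yc zc] /=|_ ->].
    by apply: bv => //; apply: weak_le_inv zv zc.
  by split; apply: PhiR_inv.
(* Otherwise [(y t)^-1] and [y^-1] have the same cone type, and the gate [y] would lie below the
   shorter [y t]. *)
have [//|h] := pselect (exists v, cone_type gen (y * gen t)^-1%g v /\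
    ~ cone_type gen y^-1%g v); exfalso.
have /weak_le_len : y <=w (y * gen t)%g.
  apply: ymin; rewrite -yT /cone_part; apply/seteqP; split => v.
    move=> v1; have [//|nv] := pselect (cone_type gen y^-1%g v).
    by case: h; exists v.
  by move=> /cone_typeVE hv; apply/cone_typeVE => c /yz[yc _]; apply: hv.
by move: yt; rewrite /DR /= => *; lenlia.
Qed.

(** [al s] is no inversion of [z], so multiplying by [s] gives [x] and the longer [s z], whose
    inversion sets meet in the reflected root only; [s z] is then cut to a tight prefix. Hence a
    search by left multiplication misses no partner. *)
Lemma partners_suffix b s x z : ln (gen s * x)%g = (ln x).+1 -> x <> 1%g ->
  partners b (gen s * x)%g z -> exists b' z', partners b' x z'.
Proof.
move=> lsx x1 [yb zb yz].
have ys : inv (gen s * x)%g (al s) by apply/(inv_gen_mul hW _ lsx); left.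
have yne : al s <> b.
  move=> bs; have := @PhiR_prefix (gen s) _ _ yb.
  have sy : gen s <=w (gen s * x)%g by rewrite /weak_le mulKg (len_gen hW) lsx.
  move=> /(_ sy); rewrite -bs => h; apply: h; last exact/(inv_gen hW).
  by move=> e; apply: x1; apply: (mulgI (gen s)); rewrite -e mulg1.
have zs : ~ inv z (al s).
  move=> zs; have : (inv (gen s * x)%g `&` inv z) (al s) by [].
  by rewrite yz => /yne.
have lsz : ln (gen s * z)%g = (ln z).+1.
  have [/(DL_pos R hW) h|//] := DLP hW z s.
  by case: zs; apply/(invE hW); split => //; apply: pos_alpha.
set b' := refl m s b.
have xb' : inv x b'.
  by have /(inv_gen_mul hW _ lsx)[e|//] := PhiR_inv yb; case: yne.
have zb' : inv (gen s * z)%g b'.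
  by apply/(inv_gen_mul hW _ lsz); right; rewrite /b' (reflK hm); apply: PhiR_inv.
have xzb c : inv x c -> inv (gen s * z)%g c -> c = b'.
  move=> xc /(inv_gen_mul hW _ lsz)[cs|zc].
    move: xc; rewrite cs => /(invE hW)[_] h; case: (posNN hW _ h).
    exact/(len_gen_mul_pos R hW).
  have yc : inv (gen s * x)%g (refl m s c).
    by apply/(inv_gen_mul hW _ lsx); right; rewrite (reflK hm).
  have : (inv (gen s * x)%g `&` inv z) (refl m s c) by [].
  by rewrite yz /b' => <-; rewrite (reflK hm).
have [z' [zz' zb'']] := exists_tight_prefix zb'; exists b', z'; split => //.
- have [t [yt be tu]] := PhiR_set1 yb.
  have xy r : DR gen x r -> DR gen (gen s * x)%g r.
    rewrite /DR /= => xr; have := lenM hW (gen s) (x * gen r)%g.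
    rewrite (len_gen hW) mulgA; have := len_mul_gen hW (gen s * x)%g r => *; lenlia.
  have bt : b' = - act x (al t).
    by rewrite /b' be (actM hW) refl_opp (act_gen hW) (reflK hm).
  have /eqP/(exists_DR hW)[r xr] := x1.
  have rt := tu r (xy r xr); rewrite rt in xr.
  apply/seteqP; split => [_ [r' /xy/tu -> <-] //|_ ->].
  by exists t.
apply/seteqP; split => [c [xc zc] /=|_ ->].
  by apply: xzb => //; apply: weak_le_inv zz' zc.
by split => //; apply: PhiR_inv.
Qed.

(** Cutting [x] and [y] to tight prefixes for [b] shrinks the intersection of inversion sets but
    keeps [b] in it. *)
Lemma super_elementaryP b :
  super_elementary m gen b <-> exists y z, partners b y z.
Proof.
split=> [[pb [x [y xy]]]|[y [z [yb zb yz]]]]; last first.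
  by split; [apply: inv_pos (PhiR_inv yb)|exists y, z].
have [xb yb] : (inv x `&` inv y) b by rewrite xy.
have [x' [xx' x'b]] := exists_tight_prefix xb.
have [y' [yy' y'b]] := exists_tight_prefix yb.
exists x', y'; split => //; apply/seteqP; split => [c [xc yc]|_ ->].
  by rewrite -xy; split; [apply: weak_le_inv xx' xc|apply: weak_le_inv yy' yc].
by split; apply: PhiR_inv.
Qed.

(** A positive root dominated by [b] is inverted by [x] and by [y] along with [b], so it lies in the
    intersection. *)
Lemma super_elementary_elementary (b : V R S) :
  super_elementary m gen b -> elementary m gen b.
Proof.
move=> [pb [x [y xy]]]; split => // a pa ba.
have [[_ xb] [_ yb]] : (inv x `&` inv y) b by rewrite xy.
have : (inv x `&` inv y) a by split; split => //; apply: ba.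
by rewrite xy.
Qed.

Lemma alpha_elementary s : elementary m gen (al s).
Proof.
split; first exact: pos_alpha.
move=> a pa /(_ (gen s)); rewrite (act_gen_alpha R hW) (act_gen hW).
have ns : neg_roots m gen (- al s) by apply/(negE hW); rewrite opprK; exact: pos_alpha.
move=> /(_ ns)/(negE hW) na; have [//|as_] := eqVneq a (al s).
by case: (posNN hW (pos_refl hW pa as_)).
Qed.

(** Each simple reflection is its own partner, so recording all of them at the start is sound. *)
Lemma partners_gen s : partners (al s) (gen s) (gen s).
Proof.
have e : PhiR m gen (gen s) = [set al s].
  apply/seteqP; split => [_ [r hr <-]|_ ->] /=.
    by apply/(inv_gen hW)/inv_DR.
  exists s; first by rewrite /DR /= (gen_sq hW) (len_gen hW) (len1 hW).
  by rewrite (act_gen_alpha R hW) opprK.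
by split => //; rewrite setIid; apply/seteqP; split => c /(inv_gen hW).
Qed.

End Gates.

(** * Dominance and discreteness of the roots *)

Section Discreteness.
Variables (R : realType) (S : finType) (W : groupType).
Variables (m : S -> S -> nat) (gen : S -> W).
Hypothesis hW : coxeter_system m gen.

Local Notation al := (@alpha R S).
Local Notation act := (@wact R S W m gen).
Local Notation B := (@form R S m).
Local Notation root := (@roots R S W m gen).
Local Notation pos := (@pos_roots R S W m gen).
Local Notation inv := (@inversions R S W m gen).
Local Notation hm := (coxeter_systemP hW).

Lemma finite_set_no_inj (T : eqType) (A : set T) (f : nat -> T) :
  finite_set A -> (forall k, A (f k)) -> injective f -> False.
Proof.
move=> /finite_seqP[l ->] fl fi.
have : (size (map f (iota 0 (size l).+1)) <= size l)%N.
  apply: uniq_leq_size; first by rewrite map_inj_uniq ?iota_uniq.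
  by move=> _ /mapP[k _ ->]; apply: fl.
by rewrite size_map size_iota ltnn.
Qed.

(* The infinite dihedral group generated by the two reflections would produce
   infinitely many inversions of [u^-1]. *)
Lemma inversions_form_gtN1 u a b : pos a -> pos b ->
  pos (- act u a) -> pos (- act u b) -> -1 < B a b.
Proof.
move=> pa pb ua ub; rewrite ltNge; apply/negP => hab.
set K := - B a b; have K1 : 1 <= K by rewrite /K; lra.
have [fa fb] := (root_form hW (pos_root pa), root_form hW (pos_root pb)).
have [ra rb] := (pos_root pa, pos_root pb).
pose g v := reflv m a (reflv m b v).
(* The orbit of [a] under the product of the two reflections. As [K] is at least 1, the coefficients
   stay nonnegative and grow, so [u] makes the whole orbit negative. *)
pose c k := iter k g a.
have cS k : exists x y, [/\ c k = x *: a + y *: b, 0 <= y, y < x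
    & total (c k) < total (c k.+1)].
  have gE x y : g (x *: a + y *: b) =
    (2 * K * (2 * K * x - y) - x) *: a + (2 * K * x - y) *: b.
    have bE : reflv m b (x *: a + y *: b) = x *: a + (2 * K * x - y) *: b.
      rewrite /reflv !formE // fb -addrA -scalerBl; congr (_ + _ *: _).
      by rewrite /K; ring.
    rewrite /g bE /reflv !formE // fa (formC hm b a) addrAC -scalerBl.
    by congr (_ *: _ + _); rewrite /K; ring.
  have [ta tb] := (total_gt0 hW pa, total_gt0 hW pb).
  have aux x y : 0 <= y -> y < x -> x < 2 * K * x - y.
    move=> y0 yx; have : 0 <= (K - 1) * x by apply: mulr_ge0; lra.
    by rewrite mulrBl mul1r; lra.
  have incr (x y : R) : 0 <= y -> y < x ->
      total (x *: a + y *: b) < total (g (x *: a + y *: b)).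
    move=> y0 yx; rewrite gE !totalD !totalZ.
    have h1 := aux x y y0 yx.
    have h2 : 2 * K * x - y < 2 * K * (2 * K * x - y) - x by apply: aux; lra.
    apply: ltrD; rewrite ltr_pM2r //; lra.
  elim: k => [|k [x [y [cE y0 yx _]]]].
    exists 1, 0; split => //; first by rewrite scale1r scale0r addr0.
    have := incr 1 0 (lexx _) ltr01; rewrite scale1r scale0r addr0; exact.
  have cSE : c k.+1 = (2 * K * (2 * K * x - y) - x) *: a + (2 * K * x - y) *: b.
    by rewrite -gE -cE.
  exists (2 * K * (2 * K * x - y) - x), (2 * K * x - y); 
  have h1 := aux x y y0 yx.
  have h2 : 2 * K * x - y < 2 * K * (2 * K * x - y) - x by apply: aux; lra.
  split => //; first by lra.
  by change (total (c k.+1) < total (g (c k.+1))); rewrite cSE; apply: incr; lra.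
have rc k : root (c k).
  by elim: k => //= k IH; do 2 apply: (root_reflv hW) => //.
have ic k : inv u^-1%g (c k).
  have [x [y [cE y0 yx _]]] := cS k.
  have x0 : 0 <= x by lra.
  apply/(invE hW); rewrite invgK; split; split; rewrite ?cE.
  - by rewrite -cE.
  - by apply: nonnegD; apply: nonnegZ => //; [case: pa|case: pb].
  - by rewrite -cE; apply/(rootN hW)/root_act.
  rewrite actD !actZ opprD -!scalerN.
  by apply: nonnegD; apply: nonnegZ => //; [case: ua|case: ub].
suff ci : injective c by exact: (finite_set_no_inj (inv_finite R hW u^-1%g) ic ci).
have mono : {homo (fun k => total (c k)) : i j / (i < j)%N >-> i < j}.
  by apply: homo_ltn => [y x z|i]; [exact: lt_trans|case: (cS i) => x [y []]].
move=> i j e; case: (ltngtP i j) => // /mono; rewrite e ltxx //.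
Qed.

(** If both failed, some [w] and [w'] would separate the two roots in opposite ways; then [act w a]
    and [- act w b] are positive roots with form at most -1, both made negative by [w' w^-1]. *)
Lemma dominates_total a b : pos a -> pos b -> 1 <= B a b ->
  dominates m gen b a \/ dominates m gen a b.
Proof.
move=> pa pb hab; have [|] := pselect (dominates m gen b a); first by left.
move=> /existsNP[w /not_implyP[/(negE hW) wb na]]; right => w' /(negE hW) wa'.
have wa : pos (act w a).
  have [//|] := pos_or_neg hW (root_act hW w (pos_root pa)).
  by move=> /(negE hW).
have [wb'|/(negE hW)//] := pos_or_neg hW (root_act hW w' (pos_root pb)).
have := @inversions_form_gtN1 (w' * w^-1)%g (act w a) (- act w b) wa wb.
rewrite !(actM hW) !actN (actK hW) opprK (actK hW) (formNr hm) (form_act hW).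
move=> /(_ wa' wb'); lra.
Qed.

Lemma elementary_form_lt1 a b : elementary m gen a -> elementary m gen b ->
  a <> b -> B a b < 1.
Proof.
move=> [pa ea] [pb eb] ab; rewrite ltNge; apply/negP => h.
have [/(eb _ pa)//|/(ea _ pb) e] := dominates_total pa pb h.
by apply: ab; rewrite e.
Qed.

(** For a dominated [a] other than [al s], reflecting back shows that [b] dominates [refl m s a].
    For [a = al s], an element making [b] negative and [al s] positive also makes [refl m s b]
    negative, against dominance. *)
Lemma elementary_refl b s : elementary m gen b -> b <> al s ->
  0 <= B b (al s) -> elementary m gen (refl m s b).
Proof.
move=> [pb eb] bs b0; have psb : pos (refl m s b) by apply: pos_refl => //; apply/eqP.
split => // a pa dom; have [as_|as_] := eqVneq a (al s).
  exfalso; have : ~ dominates m gen b (al s).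
    by move=> /(eb _ (pos_alpha R hW s)) e; apply: bs.
  move=> /existsNP[w /not_implyP[/(negE hW) wb ns]]; apply: (ns).
  have [ws|/(negE hW)//] := pos_or_neg hW (root_act hW w (root_alpha R hW s)).
  rewrite -as_; apply: dom; apply/(negE hW); split.
    exact/(rootN hW)/root_act/pos_root.
  rewrite reflE /reflv actD actN actZ opprD opprK.
  apply: nonnegD; first by case: wb.
  by apply: nonnegZ; [rewrite mulr_ge0|case: ws].
have e : refl m s a = b.
  apply: eb; first exact: pos_refl.
  move=> w wb; rewrite -(act_gen hW) -(actM hW); apply: dom.
  by rewrite (actM hW) (act_gen hW) (reflK hm).
by rewrite -e (reflK hm).
Qed.

(** * Conjugating pairs of roots into finite subsystems *)

Lemma pow2_ge (x : R) : 0 < x -> exists k : nat, 1 <= 2 ^+ k * x.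
Proof.
move=> x0; exists (Num.bound x^-1).
rewrite -ler_pdivrMr // div1r; apply: le_trans (ltW (archi_boundP _)) _.
  by rewrite invr_ge0 ltW.
by rewrite -natrX ler_nat ltnW // ltn_expl.
Qed.

(* Doubling the rotation angle until its cosine is nonpositive. *)
Lemma rotation_positive_relation (P : V R S -> Prop) (g : W) (tau : R) :
  tau < 1 -> (forall v, P v -> P (act g v)) ->
  (forall v, P v -> act g (act g v) = (2 * tau) *: act g v - v) ->
  exists (h : W) (mu : R), 0 <= mu /\
    forall v, P v -> act h (act h v) + mu *: act h v + v = 0.
Proof.
move=> t1; have [k] := pow2_ge (x := 1 - tau) ltac:(lra).
elim: k g tau t1 => [|k IH] g tau t1 hk Pg rel.
  exists g, (- (2 * tau)); split; first by lra.
  by move=> v /rel ->; rewrite scaleNr [LHS]addrAC subrK subrr.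
have [t0|t0] := lerP tau 0.
  exists g, (- (2 * tau)); split; first by lra.
  by move=> v /rel ->; rewrite scaleNr [LHS]addrAC subrK subrr.
(* Squaring replaces the cosine [tau] by [2 tau^2 - 1]; as [tau > 0], its distance to 1 at least
   doubles. *)
apply: (IH (g * g)%g (2 * tau ^+ 2 - 1)).
- by rewrite expr2; nra.
- rewrite exprS in hk; apply: le_trans hk _.
  rewrite -mulrA [2 * (_ * _)]mulrCA ler_pM2l ?exprn_gt0 // expr2; nra.
- by move=> v Pv; rewrite (actM hW); apply/Pg/Pg.
move=> v Pv; rewrite !(actM hW) (rel (act g (act g v))); last by apply/Pg/Pg.
rewrite (rel (act g v)); last exact: Pg.
set X := act g (act g v).
have vE : v = (2 * tau) *: act g v - X by rewrite /X rel // opprB addrC subrK.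
rewrite scalerBr scalerA [X in _ = _ - X]vE opprB addrAC [RHS]addrA.
congr (_ - _); transitivity ((2 * tau * (2 * tau) - 1) *: X).
  by rewrite scalerBl scale1r.
have -> : 2 * tau * (2 * tau) - 1 = 2 * (2 * tau ^+ 2 - 1) + 1 by rewrite expr2; ring.
by rewrite scalerDl scale1r.
Qed.

(** Reflecting in a simple root of negative value removes one root from the finite list of positive
    roots with negative value. *)
Lemma exists_dominant (phi : V R S -> R) :
  (forall v, phi (- v) = - phi v) -> finite_set [set v | pos v /\ phi v < 0] ->
  exists w, forall s, 0 <= phi (act w (al s)).
Proof.
move=> phiN /finite_seqP[l lE].
have : exists w, forall v, pos v -> phi (act w v) < 0 -> v \in l.
  exists 1%g => v pv; rewrite (act1 hW) => hv.
  have : [set v | pos v /\ phi v < 0] v by [].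
  by rewrite lE.
case=> w; have [n] := ubnP (size l); clear lE.
elim: n l w => // n IH l w ln hl.
have [h|/existsNP[s /negP]] := pselect (forall s, 0 <= phi (act w (al s))).
  by exists w.
rewrite -ltNge => hs; have sl := hl _ (pos_alpha R hW s) hs.
apply: (IH (map (refl m s) [seq v <- l | predC1 (al s) v]) (w * gen s)%g).
  rewrite size_map size_filter; move: ln; rewrite -(count_predC (pred1 (al s)) l).
  have : (0 < count_mem (al s) l)%N by rewrite -has_count has_pred1.
  rewrite (eq_count (a1 := predC (pred1 (al s))) (a2 := predC1 (al s))) //; lia.
move=> v pv; rewrite (actM hW) (act_gen hW) => hv.
have vs : v != al s.
  apply/eqP => e; move: hv; rewrite e (refl_alpha R hW) actN phiN; lra.
have pv' := pos_refl hW pv vs.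
apply/mapP; exists (refl m s v); last by rewrite (reflK hm).
rewrite mem_filter hl // andbT; apply/eqP => e.
have : v = - al s by rewrite -(refl_alpha R hW) -e (reflK hm).
by move=> e'; move: pv; rewrite e'; apply/(posNN hW)/pos_alpha.
Qed.

Definition supported (J : {set S}) : set (V R S) :=
  [set v | root v /\ forall s, s \notin J -> v s = 0 :> R].

(* The functional [v |-> f v + mu f (h v) + f (h^2 v)], with [f] the coordinate sum,
   vanishes on the plane of [a] and [b] and lies inside the Tits cone: it plays
   the role of a point fixed by the two reflections. *)
Lemma conj_into_finite a b : root a -> root b -> `|B a b| < 1 ->
  exists w (J : {set S}), [/\ finite_set (supported J),
    supported J (act w a) & supported J (act w b)].
Proof.
move=> ra rb; rewrite ltr_norml => /andP[k1 k2]; set K := B a b in k1 k2.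
have [wa waE] := root_reflection hW ra; have [wb wbE] := root_reflection hW rb.
have [fa fb] := (root_form hW ra, root_form hW rb).
pose P v := exists x y : R, v = x *: a + y *: b.
have gE x y : act (wa * wb)%g (x *: a + y *: b) =
    ((4 * K ^+ 2 - 1) * x + 2 * K * y) *: a + (- (2 * K) * x - y) *: b.
  have bE : reflv m b (x *: a + y *: b) = x *: a + (- (2 * K) * x - y) *: b.
    rewrite /reflv !formE // fb -/K -addrA -scalerBl; congr (_ + _ *: _).
    by ring.
  rewrite (actM hW) waE wbE bE /reflv !formE // fa (formC hm b a) -/K addrAC -scalerBl.
  by congr (_ *: _ + _); rewrite expr2; ring.
have [|||h [mu [mu0 hrel]]] := @rotation_positive_relation P (wa * wb)%g (2 * K ^+ 2 - 1).
- by rewrite expr2; nra.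
- by move=> _ [x [y ->]]; rewrite gE; eexists; eexists.
- move=> _ [x [y ->]]; rewrite (gE x y) gE [(2 * _) *: (_ + _)]scalerDr !scalerA.
  rewrite [- (_ *: a + _)]opprD addrACA -!scalerBl.
  by congr (_ *: _ + _ *: _); rewrite !expr2; ring.
pose phi v := total (act h (act h v)) + mu * total (act h v) + total v.
have phiD u v : phi (u + v) = phi u + phi v.
  by rewrite /phi !actD !totalD; ring.
have phiZ c v : phi (c *: v) = c * phi v.
  by rewrite /phi !actZ !totalZ; ring.
have phi0 v : P v -> phi v = 0.
  by move=> /hrel e; rewrite /phi -totalZ -!totalD e total0.
(* As [mu] is nonnegative, one of the three coordinate sums is nonpositive, so that image is a
   negative root; three inversion sets then contain all such positive [v]. *)
have phi_inv w v : root v -> phi (act w v) <= 0 ->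
    [\/ pos (- act w v), pos (- act (h * w)%g v) | pos (- act (h * h * w)%g v)].
  move=> rv; rewrite /phi -!(actM hW) => hphi.
  have sgn w' : pos (- act w' v) \/ 0 < total (act w' v).
    by have [/(total_gt0 hW)|] := pos_or_neg hW (root_act hW w' rv); [right|left].
  have [|t1] := sgn (h * h * w)%g; first by constructor 3.
  have [|t2] := sgn (h * w)%g; first by constructor 2.
  have [|t3] := sgn w; first by constructor 1.
  by exfalso; nra.
have fin w : finite_set [set v | pos v /\ phi (act w v) <= 0].
  apply: (sub_finite_set (B := inv w^-1%g `|` inv (h * w)^-1%g `|` inv (h * h * w)^-1%g)).
    move=> v [pv /(phi_inv _ _ (pos_root pv))[hv|hv|hv]]; [left;left|left;right|right];
      by apply/(invE hW); rewrite invgK.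
  by rewrite !finite_setU; split; [split|]; exact: inv_finite.
have [||w hw] := @exists_dominant phi.
- by move=> v; rewrite -scaleN1r phiZ mulN1r.
- apply: sub_finite_set (fin 1%g) => v [pv hv]; split => //.
  by rewrite (act1 hW) ltW.
(* [phi] after [w] is nonnegative on the simple roots, so a root where it vanishes is supported on
   the simple roots where it vanishes. *)
pose J := [set s | phi (act w (al s)) == 0]%SET.
have phiE v : phi (act w v) = \sum_s (v s : R) * phi (act w (al s)).
  rewrite {1}(vec_expand v) act_sum.
  elim/big_rec2: _ => [|s x y _ <-]; last by rewrite phiD actZ phiZ.
  by rewrite -(scale0r (0 : V R S)) phiZ mul0r.
have supp v : nonneg v -> phi (act w v) = 0 -> forall s, s \notin J -> v s = 0 :> R.
  rewrite phiE => nv /eqP; rewrite psumr_eq0; last by move=> s _; apply: mulr_ge0.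
  move=> /allP hv s; rewrite inE => hs.
  have := hv s (mem_index_enum s); rewrite /= mulf_eq0 (negbTE hs) orbF.
  by move/eqP.
have supp' v : root v -> phi (act w v) = 0 -> supported J v.
  move=> rv pv; split => // s sJ; have [[_ nv]|[_ nv]] := pos_or_neg hW rv.
    exact: supp nv pv s sJ.
  have := supp (- v) nv; rewrite actN -scaleN1r phiZ pv mulr0 => /(_ erefl s sJ).
  by rewrite ffunE => /eqP; rewrite oppr_eq0 => /eqP.
exists w^-1%g, J; split.
- have finp := fin w.
  apply: (sub_finite_set (B := [set v | pos v /\ phi (act w v) <= 0] `|`
     (-%R @` [set v | pos v /\ phi (act w v) <= 0]))).
    move=> v [rv sv].
    have z (u : V R S) : (forall s, s \notin J -> u s = 0 :> R) -> phi (act w u) = 0.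
      move=> hu; rewrite phiE big1 // => s _; have [|sJ] := boolP (s \in J).
        by rewrite inE => /eqP ->; rewrite mulr0.
      by rewrite hu // mul0r.
    have [pv|pv] := pos_or_neg hW rv; [left|right].
      by split => //; rewrite z.
    exists (- v); rewrite ?opprK //; split => //; rewrite z // => s sJ.
    by rewrite ffunE sv // oppr0.
  by rewrite finite_setU; split => //; apply: finite_image.
- apply: supp'; first exact: root_act.
  by rewrite (actVK hW) phi0 //; exists 1, 0; rewrite scale1r scale0r addr0.
- apply: supp'; first exact: root_act.
  by rewrite (actVK hW) phi0 //; exists 0, 1; rewrite scale1r scale0r add0r.
Qed.

(** By [conj_into_finite] each such value occurs within a finite root set [supported J], and there
    are finitely many [J]. *)
Lemma finite_form_values : exists Q : seq R, forall a b, root a -> root b ->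
  `|B a b| < 1 -> B a b \in Q.
Proof.
pose A (J : {set S}) : set R := if `[< finite_set (supported J) >]
  then [set B u v | u in supported J & v in supported J] else set0.
have /finite_seqP[Q QE] : finite_set (\bigcup_(J in [set: {set S}]) A J).
  apply: bigcup_finite; first exact: finite_finset.
  by move=> J _; rewrite /A; case: asboolP => // hJ; apply: finite_image2.
exists Q => a b ra rb /(conj_into_finite ra rb)[w [J [fJ aJ bJ]]].
have : (\bigcup_(J in [set: {set S}]) A J) (B a b).
  exists J => //; rewrite /A; case: asboolP => // _.
  by exists (act w a) => //; exists (act w b) => //; rewrite (form_act hW).
by rewrite QE.
Qed.

Lemma seq_pos_lower_bound (Q : seq R) :
  exists q, [/\ 0 < q, q <= 1 & forall x, x \in Q -> 0 < x -> q <= x].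
Proof.
elim: Q => [|y Q [q [q0 q1 hq]]]; first by exists 1.
have [y0|y0] := ltrP 0 y; last first.
  exists q; split => // x; rewrite inE => /orP[/eqP ->|/hq //]; lra.
exists (Num.min q y); split; rewrite ?lt_min ?ge_min ?q0 ?q1 // => x.
rewrite inE => /orP[/eqP ->|/hq h /h h']; rewrite ge_min ?lexx ?orbT //.
by rewrite h'.
Qed.

Lemma form_pos_lower_bound : exists2 q : R, 0 < q &
  forall a b, root a -> root b -> 0 < B a b -> q <= B a b.
Proof.
have [Q hQ] := finite_form_values; have [q [q0 q1 hq]] := seq_pos_lower_bound Q.
exists q => // a b ra rb ab; have [h|h] := lerP 1 (B a b); first by lra.
by apply: hq => //; apply: hQ => //; rewrite ger0_norm ?ltW.
Qed.

Lemma exists_form_gt0 v : pos v -> exists s, 0 < B v (al s).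
Proof.
move=> [rv nv]; have := root_form hW rv; rewrite (form_expand _ v v) => h.
have [//|/forallNP hn] := pselect (exists s, 0 < B v (al s)).
have : \sum_s (v s : R) * B (al s) v <= 0.
  apply: sumr_le0 => s _; apply: mulr_ge0_le0; first exact: nv.
  by rewrite (formC hm) leNgt; apply/negP/hn.
by rewrite h; lra.
Qed.

Lemma total_refl s v : total (refl m s v) = total v - 2 * B v (al s).
Proof. by rewrite reflE total_reflv total_alpha mulr1. Qed.

(** Some simple reflection lowers the coordinate sum of a nonsimple positive root by at least
    [2 * q], so boundedly many steps lead to a simple root. *)
Lemma pos_total_finite (N : R) : finite_set [set v | pos v /\ total v <= N].
Proof.
have [q q0 hq] := form_pos_lower_bound.
suff fin k : finite_set [set v | pos v /\ total v <= 2 * q * k%:R].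
  apply: (sub_finite_set _ (fin (Num.bound (N / (2 * q))))) => v [pv hv]; split => //.
  apply: le_trans hv _; rewrite mulrC -ler_pdivrMr; last by lra.
  have [N0|N0] := lerP 0 N.
    by apply/ltW/archi_boundP; rewrite divr_ge0 //; lra.
  by apply: le_trans (ler0n _ _); rewrite ltW // pmulr_llt0 // invr_gt0; lra.
elim: k => [|k IH].
  apply: (sub_finite_set (B := set0)) => // v [/(total_gt0 hW)]; rewrite mulr0 /=; lra.
apply: (sub_finite_set (B := range al `|` \bigcup_(s in [set: S])
   (refl m s @` [set v | pos v /\ total v <= 2 * q * k%:R]))).
  move=> v [pv hv]; have [s vs] := exists_form_gt0 pv.
  have [->|ns] := eqVneq v (al s); first by left; exists s.
  right; exists s => //; exists (refl m s v); last by rewrite (reflK hm).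
  split; first exact: pos_refl.
  have := hq _ _ (pos_root pv) (root_alpha R hW s) vs.
  rewrite total_refl; move: hv; rewrite -(natr1 k) mulrDr mulr1; lra.
rewrite finite_setU; split; first exact/finite_image/finite_finset.
by apply: bigcup_finite => [|s _]; [exact: finite_finset|exact: finite_image].
Qed.

End Discreteness.

(** * Finiteness of the elementary roots *)

Section Finiteness.
Variables (R : realType) (S : finType) (W : groupType).
Variables (m : S -> S -> nat) (gen : S -> W).
Hypothesis hW : coxeter_system m gen.

Local Notation ln := (len gen).
Local Notation al := (@alpha R S).
Local Notation act := (@wact R S W m gen).
Local Notation B := (@form R S m).
Local Notation root := (@roots R S W m gen).
Local Notation pos := (@pos_roots R S W m gen).
Local Notation hm := (coxeter_systemP hW).

Lemma form_alpha_le0 s t : s != t -> B (al s) (al t) <= 0.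
Proof.
move=> st; rewrite form_alpha /simple_form; have [m0|m0] := eqVneq (m s t) 0%N.
  by rewrite lerN10.
have m2 := m_ge2 hm st m0; rewrite oppr_le0 cos_ge0_pihalf //.
have p0 := pi_gt0 R; apply/andP; split.
  apply: le_trans (_ : 0 <= _); first by lra.
  by apply: divr_ge0; [exact: ltW|exact: ler0n].
by rewrite ler_pM2l // lef_pV2 ?posrE ?ltr0n ?ler_nat //; lia.
Qed.

(* The relation between an elementary root and those above it on an increasing
   chain: once [B a (al s) <= -1], the reflection in [s] is no longer used. *)
Definition chain_lt (a b : V R S) : Prop := exists d, [/\ b = a + d, nonneg d, d != 0
  & forall s, B a (al s) <= -1 -> d s = 0 :> R /\ B b (al s) <= -1].

Lemma chain_lt_trans b a c : chain_lt a b -> chain_lt b c -> chain_lt a c.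
Proof.
move=> [d [-> d0 dn hd]] [e [-> e0 en he]]; exists (d + e); split.
- by rewrite addrA.
- exact: nonnegD.
- apply/eqP => de; case/eqP: dn; apply: nonneg_opp_eq0 => //.
  by rewrite -[- d]addr0 -de addKr.
move=> s hs; have [ds bs] := hd s hs; have [es cs] := he s bs.
by rewrite ffunE ds es addr0.
Qed.

(** The difference [d] is supported where the inner products do not change, so [B d d = 0]. Then
    [B b b = B a a] gives [B a d = 0] and [B a b = 1], impossible for distinct elementary roots. *)
Lemma chain_lt_same_form a b : elementary m gen a -> elementary m gen b ->
  chain_lt a b ->
  (forall s, -1 < B a (al s) -> B a (al s) = B b (al s)) -> False.
Proof.
move=> ea eb [d [bE d0 dn hd]] hs.
have dd v : B d v = \sum_s (d s : R) * B (al s) v by rewrite form_expand.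
have dal s : -1 < B a (al s) -> B (al s) d = 0.
  by move=> h; have := hs s h; rewrite bE formDl (formC hm (al s)); lra.
have Bdd : B d d = 0.
  rewrite dd big1 // => s _; have [h|h] := ltrP (-1) (B a (al s)).
    by rewrite dal ?mulr0.
  by have [-> _] := hd s h; rewrite mul0r.
have fa := root_form hW (pos_root ea.1); have fb := root_form hW (pos_root eb.1).
have ab : a <> b.
  by move=> e; case/eqP: dn; apply: (addrI a); rewrite -bE e addr0.
have := elementary_form_lt1 hW ea eb ab; rewrite bE formDr ?fa; last exact: hm.
move: fb; rewrite bE !formE ?fa ?Bdd ?(formC hm d a); [|exact: hm..].
by lra.
Qed.

(** Descending from [v] by simple reflections gives a chain of elementary roots with pairwise
    distinct tuples of cut-off inner products. So the chain has bounded length, and each step lowers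
    the sum by less than 2. *)
Lemma elementary_total_bounded :
  exists N : R, forall v, elementary m gen v -> total v <= N.
Proof.
have [Q hQ] := finite_form_values R hW; have [q q0 hq] := form_pos_lower_bound R hW.
(* The entry 1 serves [B (al s) (al s)], as [Q] covers only absolute values below 1. In [code], the
   index [size L] stands for all values at most -1. *)
have [L LE] : exists L, L = 1 :: Q by eexists.
pose code v : {ffun S -> 'I_(size L).+1} :=
  [ffun s => inord (if B v (al s) <= -1 then size L else index (B v (al s)) L)].
have inL v s : elementary m gen v -> -1 < B v (al s) -> B v (al s) \in L.
  move=> ev h; rewrite LE inE; have [->|/eqP vs] := eqVneq v (al s).
    by rewrite (form_alphaE _ hm) eqxx.
  have h1 := elementary_form_lt1 hW ev (alpha_elementary R hW s) vs.
  apply/orP; right; apply: hQ; [exact: pos_root ev.1|exact: root_alpha|].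
  by rewrite ltr_norml h h1.
have code_neq a b : elementary m gen a -> elementary m gen b -> chain_lt a b ->
    code a != code b.
  move=> ea eb ab; apply/eqP => e; apply: (chain_lt_same_form ea eb ab) => s hs.
  have := congr1 (fun f : {ffun S -> 'I_(size L).+1} => f s : nat) e.
  have ia := inL a s ea hs; rewrite !ffunE leNgt hs /=.
  have ib : (index (B a (al s)) L < size L)%N by rewrite index_mem.
  rewrite inordK; last by rewrite ltnS ltnW.
  have [hb|hb] := lerP (B b (al s)) (-1).
    by rewrite inordK // => eb'; move: ib; rewrite eb' ltnn.
  have ib' := inL b s eb hb.
  rewrite inordK; last by rewrite ltnS ltnW // index_mem.
  by move=> ei; rewrite -(nth_index 0 ia) ei nth_index.
have chain k v : elementary m gen v -> total v <= 2 * q * k%:R ->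
    exists p : seq (V R S), [/\ uniq (map code p),
      forall x, x \in p -> elementary m gen x /\ chain_lt x v
      & total v <= 1 + 2 * (size p)%:R].
  elim: k v => [|k IH] v ev tv.
    by have := total_gt0 hW ev.1; move: tv; rewrite mulr0; lra.
  have [s vs] := exists_form_gt0 hW ev.1.
  have [->|/eqP ns] := eqVneq v (al s).
    by exists [::]; split => //; rewrite total_alpha mulr0 addr0.
  have B1 := elementary_form_lt1 hW ev (alpha_elementary R hW s) ns.
  have ev' := elementary_refl hW ev ns (ltW vs).
  have qv := hq _ _ (pos_root ev.1) (root_alpha R hW s) vs.
  have tv' : total (refl m s v) = total v - 2 * B v (al s) by exact: total_refl.
  have [|p [up hp tp]] := IH _ ev'.
    by move: tv; rewrite tv' -(natr1 k) mulrDr mulr1; lra.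
  have lt : chain_lt (refl m s v) v.
    exists ((2 * B v (al s)) *: al s); split.
    - by rewrite /refl subrK.
    - by apply: nonnegZ; [lra|exact: nonneg_alpha].
    - rewrite scaler_eq0 negb_or (root_neq0 hW (root_alpha R hW s)) andbT; lra.
    move=> r; rewrite /refl !formE; try exact: hm.
    (* For [r = s] the product exceeds -1 by [B1]. For other [r] it does not increase from
       [refl m s v] to [v], as distinct simple roots have nonpositive product. *)
    have [->|rs] := eqVneq r s; first by rewrite (form_alphaE _ hm); lra.
    have := form_alpha_le0 (s := s) (t := r); rewrite eq_sym => /(_ rs) h1 h2.
    split; last by nra.
    by rewrite !ffunE (negbTE rs) /GRing.scale /= mulr0.
  exists (refl m s v :: p); split.
  - rewrite /= up andbT; apply/mapP => -[x /hp[ex xv] e].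
    by have := code_neq _ _ ex ev' xv; rewrite e eqxx.
  - move=> x; rewrite inE => /orP[/eqP ->//|/hp[ex xv]]; split => //.
    exact: chain_lt_trans xv lt.
  rewrite /= -natr1; move: tp; rewrite tv'; lra.
exists (1 + 2 * #|{ffun S -> 'I_(size L).+1}|%:R) => v ev.
have [|p [up _ tp]] := chain (Num.bound (total v / (2 * q))) v ev.
  rewrite mulrC -ler_pdivrMr; last by lra.
  apply/ltW/archi_boundP; rewrite divr_ge0 //; last by lra.
  exact: ltW (total_gt0 hW ev.1).
apply: le_trans tp _; rewrite lerD2l ler_pM2l // ler_nat -(size_map code).
by rewrite -(card_uniqP up) max_card.
Qed.

Lemma elementary_finite : finite_set (@elementary R S W m gen).
Proof.
have [N hN] := elementary_total_bounded.
by apply: sub_finite_set (pos_total_finite hW N) => v ev; split; [case: ev|exact: hN].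
Qed.

(** * Elements whose single right-descent root is elementary *)

Lemma act_supported w w' (K : {set S}) (v : V R S) :
  (forall s, s \in K -> act w (al s) = act w' (al s)) ->
  (forall s, s \notin K -> v s = 0 :> R) -> act w v = act w' v.
Proof.
move=> hK hv; rewrite (vec_expand v) !act_sum; apply: eq_bigr => s _.
rewrite !actZ; have [sK|sK] := boolP (s \in K); first by rewrite hK.
by rewrite hv // !scale0r.
Qed.

(* Fix [w0] in the set and write [w0 = v0 u] with [u] in the parabolic subgroup of [K]
   and [v0] minimal in its coset.  Any other [w] is [v u], where [v] agrees with [v0] on
   the roots of [K]; unless [v = 1], a descent [r] of [v] lies outside [K], and then
   [total (act w (al r))] is bounded, so that [r] can be moved into [K]. *)
Lemma prescribed_simple_images_finite (K : {set S}) (a : S -> V R S) :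
  finite_set [set w : W | (forall s, s \in K -> act w (al s) = a s) /\
                          (forall s, s \notin K -> pos (act w (al s)))].
Proof.
have [n] := ubnP #|~: K|; elim: n K a => // n IH K a Kn.
set A := [set w : W | _].
have [->|/set0P[w0 [w0K w0pos]]] := eqVneq A set0; first exact: finite_set0.
(* [U u] is implied by membership of [u] in the parabolic subgroup of [K]. *)
pose U (u : W) := forall (x : V R S) s, s \notin K -> act u x s = x s :> R.
have U1 : U 1%g by move=> x s sK; rewrite (act1 hW).
have US u s : s \in K -> U u -> U (gen s * u)%g.
  move=> sK hu x r rK; rewrite (actM hW) (act_gen hW) refl_coord hu //.
  by case: eqP => [e|]; [rewrite -e (negbTE rK) in sK|rewrite mulr0 subr0].
pose P k := `[< exists u, U u /\ ln (w0 * u^-1)%g = k >].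
have exP : exists k, P k.
  by exists (ln w0); apply/asboolP; exists 1%g; rewrite invg1 mulg1.
case: (ex_minnP exP) => k /asboolP[u [Uu lu]] kmin.
set v0 := (w0 * u^-1)%g in lu.
have v0pos s : s \in K -> pos (act v0 (al s)).
  move=> sK; apply/(len_mul_gen_pos R hW).
  have [//|ls] := len_mul_gen hW v0 s.
  have : (k <= ln (v0 * gen s)%g)%N.
    apply: kmin; apply/asboolP; exists (gen s * u)%g; split; first exact: US.
    by rewrite invgM (genV hW) mulgA.
  by rewrite -lu -ls ltnn.
have UV : U u^-1%g by move=> x s sK; rewrite -[in RHS](actVK hW u x) Uu.
(* [y r] is supported on [K], where all [w] in the set agree with [w0]; hence the bound [N r] does
   not depend on [w]. *)
pose y r := act u (al r) - al r.
pose N r := total (act v0 (y r)).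
pose Kr r := (r |: K)%SET.
pose F r (b : V R S) := [set w : W |
   (forall s, s \in Kr r -> act w (al s) = if s == r then b else a s) /\
   (forall s, s \notin Kr r -> pos (act w (al s)))].
apply: (sub_finite_set (B := [set u] `|` \bigcup_(r in [set r | r \notin K])
   \bigcup_(b in [set b | pos b /\ total b <= N r]) F r b)); last first.
  rewrite finite_setU; split => //; apply: bigcup_finite => [|r /= rK].
    exact: finite_finset.
  apply: bigcup_finite => [|b _]; first exact: pos_total_finite.
  apply: IH; apply: leq_trans _ (Kn : (_ <= n)%N).
  apply: proper_card; apply/properP; split.
    by apply/fintype.subsetP => s; rewrite !inE negb_or => /andP[].
  by exists r; rewrite !inE ?eqxx // rK.
move=> w [wK wpos].
have same (x : V R S) : (forall s, s \notin K -> x s = 0 :> R) ->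
    act (w * u^-1)%g x = act v0 x.
  move=> hx; rewrite !(actM hW); apply: (act_supported (K := K)) => [s sK|s sK].
    by rewrite wK // w0K.
  by rewrite UV // hx.
have [e|/(exists_DR hW)[r /(DR_pos R hW) hr]] := eqVneq (w * u^-1)%g 1%g.
  by left => /=; rewrite -[w](mulgVK u) e mul1g.
have rK : r \notin K.
  apply/negP => rK; move: hr; rewrite same; last first.
    by move=> s sK; rewrite ffunE; case: eqP => // e; rewrite e rK in sK.
  exact/(posNN hW)/v0pos.
right; exists r => //; exists (act w (al r)); last first.
  split=> s; rewrite !inE; first by case: eqP => [->|_ /= /wK].
  by rewrite negb_or => /andP[_ /wpos].
split; first exact: wpos.
have -> : act w (al r) = act (w * u^-1)%g (al r) + act v0 (y r).
  rewrite -same.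
    rewrite -actD [y r]addrC -[X in X + _]opprK.
    by rewrite opprK addrA subrr add0r (actM hW) (actK hW).
  by move=> s sK; rewrite /y !ffunE Uu // ffunE subrr.
by have := total_gt0 hW hr; rewrite totalD totalN; rewrite /N; lra.
Qed.

(** If [t] is the only right descent and [b] its root, [w] sends [al t] to [- b] and the other
    simple roots to positive roots. *)
Lemma tight_elementary_finite :
  finite_set [set w : W | exists b : V R S, PhiR m gen w = [set b] /\ elementary m gen b].
Proof.
pose F t (b : V R S) := [set w : W |
  (forall s, s \in [set t]%SET -> act w (al s) = - b) /\
  (forall s, s \notin [set t]%SET -> pos (act w (al s)))].
apply: (sub_finite_set (B := \bigcup_(t in [set: S])
  \bigcup_(b in @elementary R S W m gen) F t b)); last first.
  apply: bigcup_finite => [|t _]; first exact: finite_finset.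
  apply: bigcup_finite => [|b _]; first exact: elementary_finite.
  exact: prescribed_simple_images_finite.
move=> w [b [wb eb]]; have [t [wt be tu]] := PhiR_set1 hW wb.
exists t => //; exists b => //; split=> s; rewrite inE.
  by move=> /eqP ->; rewrite be opprK.
move=> st; have [/tu e|] := DRP hW w s; first by rewrite e eqxx in st.
exact: (len_mul_gen_pos R hW _ _).1.
Qed.

End Finiteness.

(** * The procedure *)

Section Procedure.
Variables (R : realType) (S : finType) (W : groupType).
Variables (m : S -> S -> nat) (gen : S -> W).
Hypothesis hW : coxeter_system m gen.

Local Notation ln := (len gen).
Local Notation config := (config R S W).
Local Notation state := (state R S W).
Local Notation partners := (@partners R S W m gen).
Local Notation proc := (@process R S W m gen).
Local Notation target p := (gen p.2 * p.1)%g.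

Definition tight_elementary (x : W) :=
  exists b : V R S, PhiR m gen x = [set b] /\ elementary m gen b.

Definition state_sound (st : state) : Prop :=
  [/\ forall x, Lset st x -> tight_elementary x,
      forall b, Sset st b -> super_elementary m gen b
    & forall x, Gset st x -> tight_gates R m gen x].

Definition state_le (st st' : state) : Prop :=
  [/\ Lset st `<=` Lset st', Sset st `<=` Sset st' & Gset st `<=` Gset st'].

Lemma process_le st p : state_le st (proc st p).
Proof. by split=> x hx; left. Qed.

Lemma foldl_process_le st ps : state_le st (foldl proc st ps).
Proof.
elim: ps st => [|p ps IH] st; first by split.
have [h1 h2 h3] := process_le st p; have [k1 k2 k3] := IH (proc st p).
by split=> x; [move/h1/k1|move/h2/k2|move/h3/k3].
Qed.

Lemma process_sound st p : state_sound st -> state_sound (proc st p).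
Proof.
move=> [hL hS hG]; split.
- by move=> x [/hL//|[-> [b [yb eb]]]]; exists b.
- move=> b [/hS//|[[yb eb] [z [zL zb zy]]]].
  by apply/(super_elementaryP hW); exists z, (target p).
move=> x [/hG//|[b [z [[yb eb] [zL zb zy] xyz]]]].
have hp : partners b z (target p) by split.
apply/(tight_gatesP R hW); case: xyz => ->; exists b.
  by exists z; apply: partnersC.
by exists (target p).
Qed.

Lemma foldl_process_sound st ps : state_sound st -> state_sound (foldl proc st ps).
Proof. by elim: ps st => //= p ps IH st hst; apply/IH/process_sound. Qed.

Lemma partners_elementary b y z : partners b y z -> elementary m gen b.
Proof.
move=> h; apply: super_elementary_elementary.
by apply/(super_elementaryP hW); exists y, z.
Qed.

(** The test on the root never discards a partner, since super-elementary roots are elementary. *)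
Lemma process_add st p b z : partners b (target p) z -> Lset (proc st p) (target p).
Proof.
by move=> h; right; split=> //; exists b; split; [case: h|apply: partners_elementary h].
Qed.

Lemma foldl_process_add st ps p b z : p \in ps -> partners b (target p) z ->
  Lset (foldl proc st ps) (target p).
Proof.
elim: ps st => //= p' ps IH st; rewrite inE => /orP[/eqP ->|hp] h; last exact: IH.
by have [hL _ _] := foldl_process_le (proc st p') ps; apply/hL/(process_add _ h).
Qed.

(* Of two partners, the one processed last finds the other one in [L']. *)
Lemma foldl_process_record st ps p b z : p \in ps -> partners b (target p) z ->
  (Lset st z \/ exists2 q, q \in ps & z = target q) ->
  [/\ Sset (foldl proc st ps) b, Gset (foldl proc st ps) (target p)
    & Gset (foldl proc st ps) z].
Proof.
elim: ps st p z => // p0 ps IH st p z hp h hz.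
have now z' : partners b (target p0) z' -> Lset (proc st p0) z' ->
    [/\ Sset (foldl proc (proc st p0) ps) b,
        Gset (foldl proc (proc st p0) ps) (target p0)
      & Gset (foldl proc (proc st p0) ps) z'].
  move=> h' Lz'; have [_ kS kG] := foldl_process_le (proc st p0) ps.
  have eb := partners_elementary h'; case: (h') => yb z'b yz'.
  split; [apply: kS|apply: kG|apply: kG]; right.
  - by split => //; exists z'; split => //; rewrite setIC.
  - by exists b, z'; split; [by []|split => //; rewrite setIC|left].
  - by exists b, z'; split; [by []|split => //; rewrite setIC|right].
have [kL _ _] := process_le st p0.
move: hp; rewrite inE => /orP[/eqP pp0|hp].
  subst p; case: hz => [/kL Lz|[q]]; first exact: now.
  rewrite inE => /orP[/eqP ->|hq] zq; first by subst z; apply: now (process_add _ h).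
  subst z; have [] := IH (proc st p0) q (target p0) hq (partnersC h); last by split.
  by left; apply: process_add h.
apply: IH => //; case: hz => [/kL|[q]]; first by left.
rewrite inE => /orP[/eqP ->|hq] zq; last by right; exists q.
by subst z; left; apply: process_add (partnersC h).
Qed.

(** Layer [c.1] is about to be processed: partners of length up to [c.1] are already present, and a
    pair is recorded once both lengths are reached. A positive counter keeps the identity out of the
    current layer. *)
Definition invariant (c : config) : Prop :=
  [/\ (0 < c.1)%N, state_sound c.2,
      forall b y z, partners b y z -> (ln y <= c.1)%N -> Lset c.2 y
    & forall b y z, partners b y z -> (ln y <= c.1)%N -> (ln z <= c.1)%N ->
        Sset c.2 b /\ Gset c.2 y].

Lemma partners_neq1 b y z : partners b y z -> y <> 1%g.
Proof. by move=> [/(PhiR_inv hW) h _ _] e; move: h; rewrite e => /(inv1 hW). Qed.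

Lemma partners_len1 b y z : partners b y z -> (ln y <= 1)%N ->
  exists s, y = gen s /\ b = alpha R s.
Proof.
move=> h l1; have /eqP/(exists_DL hW)[s ys] := partners_neq1 h.
have ygs : y = gen s.
  have /(len_eq0 hW) e : ln (gen s * y)%g = 0%N by move: ys; rewrite /DL /= => *; lenlia.
  by rewrite -(gen_mulK hW s y) e mulg1.
exists s; split => //; case: h; rewrite ygs => /(PhiR_inv hW) h _ _.
exact/(inv_gen hW).
Qed.

Lemma init_invariant : invariant (init_config R gen).
Proof.
split=> //.
- split=> [_ [s _ <-]|_ [s _ <-]|_ [s _ <-]].
  + exists (alpha R s); split; last exact: alpha_elementary.
    by case: (partners_gen R hW s).
  + by apply/(super_elementaryP hW); exists (gen s), (gen s); apply: partners_gen.
  + by apply/(tight_gatesP R hW); exists (alpha R s), (gen s); apply: partners_gen.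
- by move=> b y z h /(partners_len1 h)[s [-> _]]; exists s.
by move=> b y z h /(partners_len1 h)[s [-> ->]] _; split; exists s.
Qed.

Lemma partners_layer_step c b y z : invariant c -> partners b y z ->
  ln y = c.1.+1 -> exists2 p, todo gen c p & y = target p.
Proof.
move=> [c0 _ cL _] h ly; have /eqP/(exists_DL hW)[s ys] := partners_neq1 h.
set x := (gen s * y)%g; have yE : y = (gen s * x)%g by rewrite (gen_mulK hW).
have lx : ln x = c.1 by move: ys; rewrite /DL /= -/x => *; lenlia.
have x1 : x <> 1%g by move=> e; move: lx; rewrite e (len1 hW) => lx; rewrite -lx in c0.
have lsx : ln (gen s * x)%g = (ln x).+1 by rewrite -yE lx.
have [b' [z' h']] : exists b' z', partners b' x z'.
  by apply: (partners_suffix hW lsx x1); rewrite -yE; exact: h.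
exists (x, s) => //; split; first by split => //; apply: cL h' _; rewrite lx.
by rewrite /DL /= lsx; lia.
Qed.

Lemma pass_invariant c c' : invariant c -> pass m gen c c' -> invariant c'.
Proof.
move=> ic; case: (ic) => c0 snd cL cSG [_ [ps [_ hps ->]]].
have [kL kS kG] := foldl_process_le c.2 ps.
have step b y z : partners b y z -> (ln y <= c.1.+1)%N ->
    Lset c.2 y \/ exists2 q, q \in ps & y = target q.
  move=> h; rewrite leq_eqVlt => /orP[/eqP ly|]; last by move/(cL _ _ _ h); left.
  by right; have [p /hps] := partners_layer_step ic h ly; exists p.
split=> //=; first exact: foldl_process_sound.
- move=> b y z h ly; have [/kL//|[q hq yq]] := step _ _ _ h ly; subst y.
  exact: foldl_process_add h.
move=> b y z h ly lz.
(* A partner of the new length is processed in this pass, and [foldl_process_record] applies to it;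
   a pair of older partners was recorded before. *)
have [ly'|ly'] := leqP (ln y) c.1; last first.
  have [|p /hps hp yp] := partners_layer_step ic h; first by apply/eqP; rewrite eqn_leq ly.
  subst y; have [] := @foldl_process_record c.2 ps p b z hp h; last by split.
  exact: step (partnersC h) lz.
have [lz'|lz'] := leqP (ln z) c.1; last first.
  have [|p /hps hp zp] := partners_layer_step ic (partnersC h).
    by apply/eqP; rewrite eqn_leq lz.
  subst z; have [] := @foldl_process_record c.2 ps p b y hp (partnersC h); last by split.
  by left; apply: cL h _.
by have [/kS hS /kG hG] := cSG _ _ _ h ly' lz'.
Qed.

Lemma reachable_invariant c : reachable m gen c -> invariant c.
Proof.
rewrite /reachable => h; have := init_invariant.
elim: h => // [x y xy /pass_invariant|x y z _ h1 _ h2 /h1/h2] //; exact.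
Qed.

(** * Termination and exhaustiveness *)

Lemma tight_elementary_len_bounded :
  exists N, forall x, tight_elementary x -> (ln x <= N)%N.
Proof.
have /finite_seqP[l lE] := tight_elementary_finite R hW.
exists (\max_(x <- l) ln x) => x hx.
have : [set` l] x by rewrite -lE.
by move=> /= xl; apply: (@leq_bigmax_seq _ _ _ (fun x => ln x)).
Qed.

(** Every pass raises the counter and needs an element of [L'] of that length, and these lengths are
    bounded. *)
Lemma procedure_terminates : terminates R m gen.
Proof.
have [N hN] := tight_elementary_len_bounded.
split; last first.
  move=> c /reachable_invariant[_ [cT _ _] _ _] hne.
  have fin : finite_set (todo gen c).
    apply: (sub_finite_set (B := [set x | tight_elementary x] `*` [set: S])).
      by move=> [x s] [[xL _] _]; split => //=; apply: cT.
    by apply: finite_setX; [exact: tight_elementary_finite|exact: finite_finset].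
  have /finite_seqP[l lE] := fin.
  exists (c.1.+1, foldl proc c.2 (undup l)); split => //; exists (undup l); split => //.
    exact: undup_uniq.
  by move=> p; rewrite mem_undup lE.
suff acc n (c : config) : (N < c.1 + n)%N -> invariant c ->
    Acc (fun c' c => pass m gen c c') c.
  by apply: (acc N.+1) init_invariant; rewrite /=; lia.
elim: n c => [|n IH] c hc ic; constructor => c' cc'.
  case: (cc') => -[x [xL lx]] _; case: ic => _ [cT _ _] _ _.
  by have := hN x (cT x xL); rewrite lx; lia.
have := pass_invariant ic cc'; apply: IH.
by case: cc' => _ [ps [_ _ ->]] /=; lia.
Qed.

(** Stripping first letters from a longer partner would reach a partner of length [c.1], an element
    of the empty layer. *)
Lemma partners_below_empty_layer c b y z : invariant c -> layer gen c = set0 ->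
  partners b y z -> (ln y <= c.1)%N.
Proof.
move=> [c0 _ cL _] le0; have [n] := ubnP (ln y); elim: n b y z => // n IH b y z yn h.
have [//|cy] := leqP (ln y) c.1.
have /eqP/(exists_DL hW)[s ys] := partners_neq1 h.
set x := (gen s * y)%g; have yE : y = (gen s * x)%g by rewrite (gen_mulK hW).
have ly : ln y = (ln x).+1 by move: ys; rewrite /DL /= -/x => *; lenlia.
have lsx : ln (gen s * x)%g = (ln x).+1 by rewrite -yE.
have x1 : x <> 1%g by move=> e; move: cy; rewrite ly e (len1 hW); lia.
have [b' [z' h']] : exists b' z', partners b' x z'.
  by apply: (partners_suffix hW lsx x1); rewrite -yE; exact: h.
have lx : (ln x <= c.1)%N by apply: IH h'; lenlia.
have : layer gen c x by split; [exact: cL h' lx|lenlia].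
by rewrite le0.
Qed.

End Procedure.

Theorem mainTheorem6 (R : realType) (S : finType) (W : groupType)
    (m : S -> S -> nat) (gen : S -> W) (hW : coxeter_system m gen) :
  terminates R m gen /\
  forall c : config R S W, reachable m gen c -> layer gen c = set0 ->
    Gset c.2 = tight_gates R m gen /\ Sset c.2 = super_elementary m gen.
Proof.
split; first exact: procedure_terminates.
move=> c /(reachable_invariant hW) ic le0.
have below b y z := partners_below_empty_layer hW (b := b) (y := y) (z := z) ic le0.
case: (ic) => _ [_ snS snG] _ cSG; split; apply/seteqP; split => //.
  move=> y /(tight_gatesP R hW)[b [z h]].
  by have [] := cSG _ _ _ h (below _ _ _ h) (below _ _ _ (partnersC h)).
move=> b /(super_elementaryP hW)[y [z h]].
by have [] := cSG _ _ _ h (below _ _ _ h) (below _ _ _ (partnersC h)).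
Qed.
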